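(* Consider the actuator-failure setting in the context, with $f$, $g$, $h$ polynomial. The following are equivalent: (a) for every $x\in\mathcal C$ there exists $u\in\mathbb R^p$ satisfying the set of $m$ CBF constraints $A(x)u\le\Xi(x)$; (b) there exist polynomials $\rho^0_{i,j}(x,y)$, sum-of-squares polynomials $q_S(x,y)$ and a nonnegative integer $r$, with $y\in\mathbb R^m$, such that $\phi(x,y)+\chi(x,y)+\psi(x,y)=0$ identically, where $$\phi=\sum_{S\subseteq\{1,\ldots,m+2\}}q_S\prod_{i\in S}\phi_i,\qquad\chi=\left(\Xi^T(x)y\right)^{2r},\qquad\psi=\sum_{j=1}^m\sum_{i=1}^p\rho^0_{i,j}\left[A^T(x)y\right]_i,$$ and $\phi_1,\ldots,\phi_{m+2}$ is the list $y_1,\ldots,y_m,\ -\Xi^T(x)y,\ h(x)$.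
   Context: System: $dx_t=(f(x_t)+g(x_t)u^F_t)\,dt$, $x_t\in\mathbb R^n$, $u_t\in\mathbb R^p$, with actuator output $u^F_t=L_ju_t$ under failure pattern $L_j$, $j=1,\ldots,m$; each $L_j$ is a $p\times p$ diagonal 0/1 matrix (zero diagonal entries mark failed actuators), and the system remains controllable under each $L_j$. Safe region $\mathcal C=\{x:h(x)\ge0\}$. Constraint data: $A(x)\in\mathbb R^{m\times p}$ has $j$-th row $-\frac{\partial h}{\partial x}g(x)L_j$, and $\Xi(x)=[\xi(x),\ldots,\xi(x)]^T\in\mathbb R^m$ with $\xi(x)=\frac{\partial h}{\partial x}f(x)+h(x)$. *)

(* Defs.v *)
From HB Require Import structures.
From mathcomp Require Import all_boot all_order all_algebra.
From mathcomp Require Import mpoly.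
From mathcomp Require Import reals constructive_ereal classical_sets.
From mathcomp Require Import measure lebesgue_measure lebesgue_integral.

Set Implicit Arguments.
Unset Strict Implicit.
Unset Printing Implicit Defensive.

Import Order.TTheory GRing.Theory Num.Theory.

Local Open Scope ring_scope.

Definition mx_eval (R : realType) (n a b : nat)
    (M : 'M[{mpoly R[n]}]_(a, b)) (x : 'cV[R]_n) : 'M[R]_(a, b) :=
  map_mx (meval (fun k => x k 0)) M.

Definition failure_pattern (R : realType) (p : nat) (L : 'M[R]_p) : Prop :=
  is_diag_mx L /\ forall i, L i i = 0 \/ L i i = 1.

Section Dynamics.
Variables (R : realType) (n p : nat).
Variables (f : 'cV[{mpoly R[n]}]_n) (g : 'M[{mpoly R[n]}]_(n, p)).
Variable L : 'M[R]_p.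
Local Open Scope classical_set_scope.

Let mu := @lebesgue_measure R.

Definition velocity (x : 'cV[R]_n) (u : 'cV[R]_p) : 'cV[R]_n :=
  mx_eval f x + mx_eval g x *m (L *m u).

(* Caratheodory solution on [0, T] of dx_t = (f(x_t) + g(x_t) L u_t) dt with
   a measurable control u: the differential equation in integral form. *)
Definition trajectory (T : R) (u : R -> 'cV[R]_p) (x : R -> 'cV[R]_n) : Prop :=
  [/\ forall k, measurable_fun `[0, T] (fun t => u t k 0),
      forall k, integrable mu `[0, T]
        (fun t => EFin (velocity (x t) (u t) k 0)) &
      forall t, 0 <= t <= T -> forall k,
        x t k 0 = x 0 k 0
          + Rintegral mu `[0, t] (fun s => velocity (x s) (u s) k 0)].

Definition controllable : Prop :=
  forall x0 x1 : 'cV[R]_n, exists T u x,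
    [/\ 0 <= T, trajectory T u x, x 0 = x0 & x T = x1].

End Dynamics.

Section ConstraintData.
Variables (R : realType) (n p m : nat).
Variables (f : 'cV[{mpoly R[n]}]_n) (g : 'M[{mpoly R[n]}]_(n, p)).
Variable h : {mpoly R[n]}.
Variable L : 'I_m -> 'M[R]_p.

Definition gradient : 'rV[{mpoly R[n]}]_n := \row_k mderiv k h.

(* Row j of A(x) u <= Xi(x) reads dh/dx (f(x) + g(x) L_j u) >= - h(x). *)
Definition cbf_A : 'M[{mpoly R[n]}]_(m, p) :=
  \matrix_(j < m) (- (gradient *m g *m map_mx (@mpolyC n R) (L j))).

Definition cbf_xi : {mpoly R[n]} := (gradient *m f) 0 0 + h.

Definition cbf_Xi : 'cV[{mpoly R[n]}]_m := const_mx cbf_xi.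

(* Polynomials in (x, y) live in {mpoly R[n + m]}: the first n variables are
   those of x, the last m those of y. *)
Definition lift_x (a : {mpoly R[n]}) : {mpoly R[n + m]} :=
  comp_mpoly [tuple 'X_(lshift m k) | k < n] a.

Definition yvar : 'cV[{mpoly R[n + m]}]_m := \col_j 'X_(rshift n j).

Definition XiTy : {mpoly R[n + m]} := ((map_mx lift_x cbf_Xi)^T *m yvar) 0 0.

Definition ATy : 'cV[{mpoly R[n + m]}]_p := (map_mx lift_x cbf_A)^T *m yvar.

Definition phi_list : (m + 2).-tuple {mpoly R[n + m]} :=
  [tuple of [tuple yvar j 0 | j < m] ++ [tuple - XiTy; lift_x h]].

Definition phi (q : {set 'I_(m + 2)} -> {mpoly R[n + m]}) : {mpoly R[n + m]} :=
  \sum_(S : {set 'I_(m + 2)}) q S * \prod_(i in S) tnth phi_list i.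

Definition chi (r : nat) : {mpoly R[n + m]} := XiTy ^+ (2 * r).

Definition psi (rho : 'I_p -> 'I_m -> {mpoly R[n + m]}) : {mpoly R[n + m]} :=
  \sum_(j < m) \sum_(i < p) rho i j * ATy i 0.

End ConstraintData.

Definition is_sos (R : realType) (k : nat) (q : {mpoly R[k]}) : Prop :=
  exists s : seq {mpoly R[k]}, q = \sum_(a <- s) a ^+ 2.

(* Main.v *)
(* The constraints [A(x) u <= Xi(x)] are solvable at [x] unless some [y >= 0] has
   [A(x)^T y = 0] and [Xi(x)^T y < 0], so (a) says that the system
   [y >= 0, - Xi^T y >= 0, h >= 0, A^T y = 0, Xi^T y <> 0] has no real solution,
   and (b) is the certificate that Stengle's Positivstellensatz attaches to it.
   For (b) => (a) no Farkas lemma is needed: if [xi(x) < 0], evaluating the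
   certificate at [y = e_j] shows that row [j] of [A(x)] is nonzero, and since
   the [L_j] are 0/1 diagonal matrices a large multiple of [dh/dx g] satisfies
   all constraints at once.

   For the Positivstellensatz, a cone without certificate lies in a maximal one
   (Zorn), hence gives a ring morphism from the polynomials to some ordered field
   [K]. Its sign conditions are brought back to the reals by eliminating one
   variable at a time in the manner of Cohen and Hormander. No real closure of
   [K] is used: elimination needs the intermediate value property only for
   finitely many polynomials, and this holds in an ordered extension of [K] where
   their product has the largest possible number of roots. *)

From HB Require Import structures.
Require Import Defs.
From mathcomp Require Import all_boot all_order all_algebra.
From mathcomp Require Import ring_quotient fraction generic_quotient.
From mathcomp Require Import polyorder polyrcf.
From mathcomp Require Import mpoly reals.
From mathcomp Require Import zify ring lra.
From mathcomp Require Import boolp classical_sets.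

Set Implicit Arguments.
Unset Strict Implicit.
Unset Printing Implicit Defensive.

Import Order.TTheory GRing.Theory Num.Theory.

Local Open Scope ring_scope.

(** * Ordered fields from cones *)

(** The order is [x <= y] iff [N (y - x)]; [K] is [F] itself with this order, and [i] is the
    identity. *)
Lemma ordered_field_of_cone (F : fieldType) (N : F -> Prop) :
  (forall x y, N x -> N y -> N (x + y)) ->
  (forall x y, N x -> N y -> N (x * y)) ->
  (forall x, N x -> N (- x) -> x = 0) ->
  (forall x, N x \/ N (- x)) ->
  exists (K : realFieldType) (i : {rmorphism F -> K}),
    forall x, 0 <= i x <-> N x.
Proof.
move=> ND NM Nanti Ntot.
pose le (x y : F) := `[< N (y - x) >].
pose lt (x y : F) := (y != x) && le x y.
pose norm (x : F) := if le 0 x then x else - x.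
have le0E x : le 0 x = `[< N x >] by rewrite /le subr0.
have lex0 x : le x 0 = `[< N (- x) >] by rewrite /le sub0r.
have le0D x y : le 0 x -> le 0 y -> le 0 (x + y).
  by rewrite !le0E => /asboolP Nx /asboolP Ny; apply/asboolP/ND.
have le0M x y : le 0 x -> le 0 y -> le 0 (x * y).
  by rewrite !le0E => /asboolP Nx /asboolP Ny; apply/asboolP/NM.
have le0_anti x : le 0 x -> le x 0 -> x = 0.
  by rewrite le0E lex0 => /asboolP Nx /asboolP Nnx; apply: Nanti.
have sub0 x y : le 0 (y - x) = le x y by rewrite /le subr0.
have le0_tot x : le 0 x || le x 0.
  by rewrite le0E lex0; case: (Ntot x) => /asboolP ->; rewrite ?orbT.
have normN x : norm (- x) = norm x.
  rewrite /norm !le0E opprK.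
  case: (asboolP (N x)) => Nx; case: (asboolP (N (- x))) => Nnx //.
    by rewrite (Nanti _ Nx Nnx) oppr0.
  by case: (Ntot x).
have ge0n x : le 0 x -> norm x = x by rewrite /norm => ->.
pose mx := Num.IntegralDomain_isLeReal.Build F le0D le0M le0_anti sub0 le0_tot
  normN ge0n (fun x y => erefl (lt x y)).
pose K : realFieldType := HB.pack F mx.
exists K, (idfun : {rmorphism K -> K}) => x /=.
split=> [|Nx]; first by move/asboolP; rewrite subr0.
by apply/asboolP; rewrite subr0.
Qed.

(** Serves to write every element of the fraction field as a quotient of elements of [D]. *)
Lemma mul_pi_tofrac (D : idomainType) (y : {ratio D}) :
  (\pi_{fraction D} y)%qT * FracField.tofrac (frac y).2
  = FracField.tofrac (frac y).1.
Proof.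
have dy : (frac y).2 != 0 := denom_ratioP y.
unlock FracField.tofrac.
rewrite -[LHS]FracField.pi_mul.
apply/eqmodP; rewrite /= FracField.equivfE /FracField.mulf /=.
by rewrite !numden_Ratio ?oner_eq0 // ?mulr1 // mulrC.
Qed.

(** Inverses of units are chosen classically, which makes [B] an integral domain structure; [F] is
    its fraction field. *)
Lemma field_of_idomain (B : comNzRingType) :
  (forall x y : B, x * y = 0 -> (x == 0) || (y == 0)) ->
  exists (F : fieldType) (i : {rmorphism B -> F}),
    injective i /\ forall x, exists a b, i b != 0 /\ x = i a / i b.
Proof.
move=> Bdom.
pose unit (x : B) := `[< exists y, y * x = 1 >].
pose inv (x : B) :=
  if pselect (exists y, y * x = 1) is left h then projT1 (cid h) else x.
have mulVx : {in unit, left_inverse 1 inv *%R}.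
  move=> x /asboolP ux; rewrite /inv; case: pselect => // h.
  exact: projT2 (cid h).
have unitPl x y : y * x = 1 -> unit x by move=> yx; apply/asboolP; exists y.
have inv_out : {in [predC unit], inv =1 id}.
  by move=> x; rewrite inE /= => /asboolPn nux; rewrite /inv; case: pselect.
pose mu := GRing.ComNzRing_hasMulInverse.Build B mulVx unitPl inv_out.
pose U : comUnitRingType := HB.pack B mu.
pose md := GRing.ComUnitRing_isIntegral.Build U Bdom.
pose D : idomainType := HB.pack U md.
exists {fraction D}, (@FracField.tofrac D : {rmorphism D -> {fraction D}}).
split=> [x y /eqP|x]; first by rewrite tofrac_eq => /eqP.
elim/quotW: x => y.
exists (frac y).1, (frac y).2; split.
  by rewrite tofrac_eq0 denom_ratioP.
apply: (canRL (mulfK _)); first by rewrite tofrac_eq0 denom_ratioP.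
exact: mul_pi_tofrac.
Qed.

(** [F] is the fraction field of the quotient of [A] by [I]. *)
Lemma field_of_prime_ideal (A : comNzRingType) (I : A -> Prop) :
  I 0 -> ~ I 1 -> (forall x y, I x -> I y -> I (x - y)) ->
  (forall a x, I x -> I (a * x)) ->
  (forall x y, I (x * y) -> I x \/ I y) ->
  exists (F : fieldType) (i : {rmorphism A -> F}),
    (forall a, i a = 0 <-> I a) /\
    forall x, exists a b, i b != 0 /\ x = i a / i b.
Proof.
move=> I0 I1 IB IM Iprime.
pose S : pred A := fun x => `[< I x >].
have S_ideal : idealr_closed S.
  split; first exact/asboolP.
    by apply/negP => /asboolP.
  move=> a x y /asboolP Ix /asboolP Iy; apply/asboolP.
  by rewrite -[y]opprK; apply: (IB); [apply: IM | rewrite -sub0r; apply: IB].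
have S_prime : prime_idealr_closed S.
  by move=> x y /asboolP /Iprime [] H; apply/orP; [left|right]; apply/asboolP.
pose mi := isIdealr.Build A S S_ideal.
pose mp := isPrimeIdealrClosed.Build A S S_prime.
pose J : prime_idealr A := HB.pack S mi mp.
have [F [i [i_inj i_frac]]] := field_of_idomain (@Quotient.rquot_IdomainAxiom _ J).
pose p : {rmorphism A -> {ideal_quot J}} := \pi_({ideal_quot J})%qT.
exists F, (i \o p : {rmorphism A -> F}); split=> [a|x].
  have pE : (p a == 0) = (a \in J).
    rewrite -(rmorph0 p) -[a in RHS]subr0.
    exact/esym/Quotient.idealrBE.
  split=> [/= ia0|Ia /=].
    have /eqP : p a = 0 by apply: i_inj; rewrite rmorph0.
    by rewrite pE => /asboolP.
  have /eqP-> : p a == 0 by rewrite pE; apply/asboolP.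
  by rewrite rmorph0.
have [a [b [ib ->]]] := i_frac x.
exists (repr a), (repr b) => /=.
by rewrite /p /= !reprK.
Qed.

Definition cone (A : comNzRingType) (T : A -> Prop) : Prop :=
  [/\ forall x y, T x -> T y -> T (x + y),
      forall x y, T x -> T y -> T (x * y) &
      forall x, T (x ^+ 2)].

(** The exponent [r = 0] excludes [-1], so a cone [T] is proper; all [r] together say that it stays
    proper once [s] is inverted. *)
Definition avoids (A : comNzRingType) (s : A) (T : A -> Prop) : Prop :=
  forall r, ~ T (- s ^+ (2 * r)).

(** In a product, the two multiples of [a] give [a ^+ 2 * (y * y')], which lies in [T] since squares
    do. *)
Lemma cone_adjoin (A : comNzRingType) (T : A -> Prop) (a : A) :
  cone T -> cone (fun z => exists x y, [/\ T x, T y & z = x + a * y]).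
Proof.
case=> TD TM Tsq; split.
- move=> _ _ [x [y [Tx Ty ->]]] [x' [y' [Tx' Ty' ->]]].
  exists (x + x'), (y + y'); split; [exact: TD|exact: TD|].
  by rewrite mulrDr addrACA.
- move=> _ _ [x [y [Tx Ty ->]]] [x' [y' [Tx' Ty' ->]]].
  exists (x * x' + a ^+ 2 * (y * y')), (x * y' + y * x'); split.
  + by apply: (TD); apply: (TM) => //; apply: TM.
  + by apply: (TD); apply: TM.
  + ring.
- move=> x; exists (x ^+ 2), (0 ^+ 2); split=> //.
  by rewrite expr0n mulr0 addr0.
Qed.

Lemma maximal_cone (A : comNzRingType) (s : A) (T : A -> Prop) :
  cone T -> avoids s T ->
  exists N : A -> Prop, [/\ cone N, avoids s N, (forall x, T x -> N x) &
    forall a, N a \/ exists x y r, [/\ N x, N y & x + a * y = - s ^+ (2 * r)]].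
Proof.
move=> [TD TM Tsq] Ts.
(* The property bears on [T] together with [X], so that the union of the empty chain satisfies it
   too. *)
pose P : set (set A) :=
  fun X => cone (T `|` X)%classic /\ avoids s (T `|` X)%classic.
have [F FP Ftot|X [[Xcone Xs] Xmax]] := @Zorn_bigcup A P.
  have both x y : (T `|` \bigcup_(X in F) X)%classic x ->
      (T `|` \bigcup_(X in F) X)%classic y ->
      (T x /\ T y) \/ exists2 X, F X & (T `|` X)%classic x /\ (T `|` X)%classic y.
    move=> [Tx|[X FX Xx]] [Ty|[Y FY Yy]].
    - by left.
    - by right; exists Y => //; split; [left|right].
    - by right; exists X => //; split; [right|left].
    - have [XY|YX] := Ftot _ _ FX FY.
        by right; exists Y => //; split; right=> //; apply: XY.
      by right; exists X => //; split; right=> //; apply: YX.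
  have up X x : F X -> (T `|` X)%classic x -> (T `|` \bigcup_(X in F) X)%classic x.
    by move=> FX [Tx|Xx]; [left|right; exists X].
  split; first split.
  - move=> x y Hx Hy; have [[Tx Ty]|[X FX [Xx Xy]]] := both x y Hx Hy.
      by left; apply: TD.
    by apply: (up X) => //; have [[XD _ _] _] := FP _ FX; apply: XD.
  - move=> x y Hx Hy; have [[Tx Ty]|[X FX [Xx Xy]]] := both x y Hx Hy.
      by left; apply: TM.
    by apply: (up X) => //; have [[_ XM _] _] := FP _ FX; apply: XM.
  - by move=> x; left.
  - move=> r [/Ts //|[X FX Xs]].
    by have [_ /(_ r)] := FP _ FX; apply; right.
exists (T `|` X)%classic; split=> // [x Tx|a]; first by left.
have [Na|nNa] := pselect ((T `|` X)%classic a); first by left.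
right; apply: contrapT => noid.
(* The cone obtained by adjoining [a] would still avoid [s] and be strictly larger. *)
pose B : set A := fun z => exists x y,
  [/\ (T `|` X)%classic x, (T `|` X)%classic y & z = x + a * y].
have [_ _ Nsq] := Xcone.
have NB x : (T `|` X)%classic x -> B x.
  move=> Nx; exists x, (0 ^+ 2); split=> //.
  by rewrite expr0n mulr0 addr0.
have TB : (T `|` B = B)%classic by apply/setUidr => x Tx; apply: NB; left.
apply: (Xmax B); last first.
  split; rewrite TB; first exact: cone_adjoin.
  by move=> r [x [y [Nx Ny xy]]]; apply: noid; exists x, y, r; split.
split; first by move=> x Xx; apply: NB; right.
move=> BX; apply: nNa; right; apply: BX.
exists (0 ^+ 2), (1 ^+ 2); split=> //.
by rewrite expr1n expr0n add0r mulr1.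
Qed.

(** For a maximal cone [N] avoiding [s], [N] and [- N] cover the ring and meet in a prime ideal; [N]
    then orders the fraction field of the quotient. *)
Lemma ordered_field_of_avoiding_cone (A : comNzRingType) (s : A) (T : A -> Prop) :
  cone T -> avoids s T ->
  exists (K : realFieldType) (i : {rmorphism A -> K}),
    i s != 0 /\ forall x, T x -> 0 <= i x.
Proof.
move=> Tcone Ts.
have [N [[ND NM Nsq] Ns TN Nmax]] := maximal_cone Tcone Ts.
have Ntot a : N a \/ N (- a).
  have [Na|[x [y [r [Nx Ny e1]]]]] := Nmax a; first by left.
  have [Na|[x' [y' [r' [Nx' Ny' e2]]]]] := Nmax (- a); first by right.
  exfalso; apply: (Ns (r + r')).
  (* Expansion of the product of [s ^+ (2 * r) + x = - a * y] and [s ^+ (2 * r') + x' = a * y']. *)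
  have -> : - s ^+ (2 * (r + r')) = a ^+ 2 * (y * y') +
      (x * x' + (s ^+ r') ^+ 2 * x + (s ^+ r) ^+ 2 * x').
    have e3 : s ^+ (2 * r) = - (x + a * y) by rewrite e1 opprK.
    have e4 : s ^+ (2 * r') = - (x' - a * y') by rewrite -mulNr e2 opprK.
    rewrite mulnDr exprD -!exprM ![(_ * 2)%N]mulnC e3 e4; ring.
  by do !(apply: (ND) || apply: (NM)) => //; rewrite -exprM mulnC.
pose I a := N a /\ N (- a).
have N0 : N 0 by have := Nsq 0; rewrite expr0n.
have I0 : I 0 by split; rewrite ?oppr0.
have I1 : ~ I 1 by case=> _; have := Ns 0; rewrite muln0 expr0.
have IN x : I x -> I (- x) by case=> ? ?; split; rewrite ?opprK.
have ID x y : I x -> I y -> I (x + y).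
  by move=> [? ?] [? ?]; split; rewrite ?opprD; apply: ND.
have IM a x : I x -> I (a * x).
  move=> [Nx Nnx]; have [Na|Na] := Ntot a.
    by split; rewrite -?mulrN; apply: NM.
  by split; [rewrite -mulrNN | rewrite -mulNr]; apply: NM.
(* The same product, now equal to [y * y' * (a * b)], whose opposite is in [N] because [a * b] lies
   in the ideal. *)
have Iprime0 a b : ~ N a -> ~ N b -> ~ I (a * b).
  move=> nNa nNb Iab.
  have [//|[x [y [r [Nx Ny e1]]]]] := Nmax a.
  have [//|[x' [y' [r' [Nx' Ny' e2]]]]] := Nmax b.
  apply: (Ns (r + r')).
  have -> : - s ^+ (2 * (r + r')) = - (y * y' * (a * b)) +
      (x * x' + (s ^+ r') ^+ 2 * x + (s ^+ r) ^+ 2 * x').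
    have e3 : s ^+ (2 * r) = - (x + a * y) by rewrite e1 opprK.
    have e4 : s ^+ (2 * r') = - (x' + b * y') by rewrite e2 opprK.
    rewrite mulnDr exprD -!exprM ![(_ * 2)%N]mulnC e3 e4; ring.
  apply: (ND); first by case: (IM (y * y') _ Iab).
  by do !(apply: (ND) || apply: (NM)) => //; rewrite -exprM mulnC.
have Iprime a b : I (a * b) -> I a \/ I b.
  move=> Iab; apply: contrapT => /not_orP [nIa nIb].
  have sgn c : ~ I c -> ~ N c \/ ~ N (- c) by move=> /not_andP.
  case: (sgn _ nIa) => nNa; case: (sgn _ nIb) => nNb.
  - exact: Iprime0 nNa nNb Iab.
  - by apply: Iprime0 nNa nNb _; rewrite mulrN; apply: IN.
  - by apply: Iprime0 nNa nNb _; rewrite mulNr; apply: IN.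
  - by apply: Iprime0 nNa nNb _; rewrite mulrNN.
have [F [j [jI jfrac]]] := field_of_prime_ideal I0 I1
  (fun x y Ix Iy => ID _ _ Ix (IN _ Iy)) IM Iprime.
have j0 a : I a -> j a = 0 by move/jI.
(* [N] is a union of classes modulo the ideal, so signs pass to the quotient. *)
have Nj a b : N a -> j a = j b -> N b.
  move=> Na jab; have /jI [_ Nab] : j (a - b) = 0 by rewrite rmorphB jab subrr.
  by rewrite -(subKr a b); apply: ND.
pose NF (x : F) := exists a b, [/\ N a, N b, j b != 0 & x = j a / j b].
have NFpos a b : j b != 0 -> N (a * b) -> NF (j a / j b).
  move=> jb Nab; exists (a * b), (b ^+ 2); split=> //.
    by rewrite rmorphXn expf_neq0.
  by rewrite rmorphXn rmorphM -mulf_div divff // mulr1.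
have [||||K [i iN]] := @ordered_field_of_cone F NF.
- move=> _ _ [a [b [Na Nb jb ->]]] [c [d [Nc Nd jd ->]]].
  exists (a * d + c * b), (b * d); split.
  + by apply: (ND); apply: NM.
  + exact: NM.
  + by rewrite rmorphM mulf_neq0.
  + by rewrite addf_div // -!rmorphM -rmorphD.
- move=> _ _ [a [b [Na Nb jb ->]]] [c [d [Nc Nd jd ->]]].
  exists (a * c), (b * d); split; [exact: NM|exact: NM| |].
  + by rewrite rmorphM mulf_neq0.
  + by rewrite mulf_div -!rmorphM.
- move=> _ [a [b [Na Nb jb ->]]] [c [d [Nc Nd jd]]].
  move=> /eqP; rewrite -mulNr eqr_div // -rmorphN -!rmorphM => /eqP jeq.
  have Nad : N (- (a * d)) by rewrite -mulNr; apply: Nj (esym jeq); apply: NM.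
  have /eqP : j (a * d) = 0 by apply/jI; split=> //; apply: NM.
  by rewrite rmorphM mulf_eq0 (negPf jd) orbF => /eqP->; rewrite mul0r.
- move=> x; have [a [b [jb ->]]] := jfrac x.
  have [Nab|Nab] := Ntot (a * b); [left|right]; first exact: NFpos.
  by rewrite -mulNr -rmorphN; apply: NFpos => //; rewrite mulNr.
exists K, (i \o j : {rmorphism A -> K}); split=> /=.
  rewrite fmorph_eq0; apply/eqP => /jI Is.
  (* If [s] were in the ideal, [- s ^+ 2] would be in [N]. *)
  by apply: (Ns 1); rewrite muln1 exprS expr1 -mulrN; case: (IM s _ Is) => _; rewrite mulrN.
move=> x /TN Nx; apply/iN; exists x, 1; split=> //.
- by rewrite -(expr1n A 2).
- by rewrite rmorph1 oner_neq0.
- by rewrite rmorph1 divr1.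
Qed.

(** * Adjoining roots to ordered fields *)

(** Weights are kept because a nonnegative element of [F] need not be a square. *)
Definition wsos (F : realFieldType) (w : seq (F * {poly F})) : {poly F} :=
  \sum_(c <- w) c.1 *: c.2 ^+ 2.

Definition weights_ge0 (F : realFieldType) (w : seq (F * {poly F})) : bool :=
  all (fun c => 0 <= c.1) w.

Lemma wsos_ge0 (F : realFieldType) (w : seq (F * {poly F})) x :
  weights_ge0 w -> 0 <= (wsos w).[x].
Proof.
elim: w => [|c w IHw] /=; first by rewrite /wsos big_nil horner0.
case/andP=> c0 /IHw; rewrite /wsos big_cons hornerD hornerZ horner_exp.
by move=> w0; rewrite addr_ge0 // mulr_ge0 // sqr_ge0.
Qed.

(* Reducing the squares modulo [q], the cofactor changes sign between [a] and
   [b] as [q] does and has smaller degree: infinite descent. *)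
Lemma wsos_not_multiple (F : realFieldType) (a b : F) (q g : {poly F}) w :
  q.[a] * q.[b] < 0 -> weights_ge0 w -> 1 + wsos w <> q * g.
Proof.
have [n] := ubnP (size q); elim: n => // n IHn in q g w *.
rewrite ltnS => qn qab w0 e.
pose w' := [seq (c.1, c.2 %% q) | c <- w].
have w'0 : weights_ge0 w' by rewrite /weights_ge0 all_map.
have q0 : q != 0 by apply: contraTneq qab => ->; rewrite !horner0 mulr0 ltxx.
have [g' e'] : exists g', 1 + wsos w' = q * g'.
  have [k ek] : exists k, wsos w = wsos w' + q * k.
    rewrite /w' /wsos; elim: (w) => [|c v [k IHv]].
      by exists 0; rewrite /= !big_nil mulr0 addr0.
    exists (c.1 *: (c.2 %/ q * (c.2 + c.2 %% q)) + k).
    rewrite /= !big_cons IHv /= mulrDr addrACA; congr (_ + _).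
    rewrite -scalerAr -scalerDr; congr (_ *: _).
    rewrite mulrA [q * _]mulrC; set r := c.2 %% q.
    have -> : c.2 %/ q * q = c.2 - r by rewrite {2}(divp_eq c.2 q) addrK.
    ring.
  by exists (g - k); rewrite mulrBr -e ek; ring.
have sign x : 0 < q.[x] * g'.[x].
  rewrite -hornerM -e' hornerD hornerC.
  by rewrite ltr_pwDl // wsos_ge0.
have g'ab : g'.[a] * g'.[b] < 0.
  have := sign a; have := sign b; move: qab.
  case: (ltrgt0P q.[a]) => [qa|qa|->]; last by rewrite mul0r ltxx.
    rewrite (pmulr_rlt0 _ qa) (pmulr_rgt0 _ qa) => qb.
    by rewrite (nmulr_rgt0 _ qb) => gb ga; rewrite pmulr_rlt0.
  rewrite (nmulr_rlt0 _ qa) (nmulr_rgt0 _ qa) => qb.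
  by rewrite (pmulr_rgt0 _ qb) => gb ga; rewrite nmulr_rlt0.
have q1 : (1 < size q)%N.
  rewrite ltnNge; apply/negP => /size1_polyC qE.
  by move: qab; rewrite qE !hornerC -expr2 ltNge sqr_ge0.
have sw' : (size (1 + wsos w')%R <= (size q).-1 + (size q).-1)%N.
  apply: leq_trans (size_polyD _ _) _; rewrite geq_max size_poly1.
  apply/andP; split; first by case: (size q) q1 => [|[|]].
  rewrite /wsos /w' big_map; apply: (big_ind (fun p : {poly F} => (size p <= _)%N)).
  - by rewrite size_poly0.
  - by move=> x y sx sy; apply: leq_trans (size_polyD _ _) _; rewrite geq_max sx.
  - move=> c _ /=; apply: leq_trans (size_scale_leq _ _) _.
    rewrite expr2; apply: leq_trans (size_polyMleq _ _) _.
    have := ltn_modp c.2 q; rewrite q0 => sm.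
    have smq : (size (c.2 %% q)%R <= (size q).-1)%N by case: (size q) sm.
    by apply: leq_trans (leq_pred _) _; apply: leq_add.
(* The roles are exchanged: [q] is now the cofactor of [g'] in the sum given by [w']. *)
apply: (IHn g' q w'); last first.
- by rewrite e' mulrC.
- by [].
- by [].
have g'0 : g' != 0 by apply: contraTneq g'ab => ->; rewrite !horner0 mulr0 ltxx.
move: sw'; rewrite e' size_mul //; move: (size q) (size g') q1 qn => sq sg' q1 qn.
lia.
Qed.

(** This cone is generated by the nonnegative constants and the multiples of [q]; an ordered field
    attached to it extends the order of [F] and sends [q] to 0. *)
Lemma wsos_cone (F : realFieldType) (q : {poly F}) :
  cone (fun f => exists w g, weights_ge0 w /\ f = wsos w + q * g).
Proof.
split.
- move=> _ _ [w [g [w0 ->]]] [v [k [v0 ->]]].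
  exists (w ++ v), (g + k); split; first by rewrite /weights_ge0 all_cat; apply/andP.
  by rewrite /wsos big_cat /= mulrDr addrACA.
- move=> _ _ [w [g [w0 ->]]] [v [k [v0 ->]]].
  have [u [u0 eu]] : exists u, weights_ge0 u /\ wsos w * wsos v = wsos u.
    exists [seq (c.1 * d.1, c.2 * d.2) | c <- w, d <- v]; split.
      apply/allP => _ /allpairsP [[c d] /= [cw dv ->]] /=.
      by rewrite mulr_ge0 ?(allP w0 _ cw) ?(allP v0 _ dv).
    rewrite /wsos big_allpairs_dep mulr_suml; apply: eq_bigr => c _.
    rewrite mulr_sumr; apply: eq_bigr => d _ /=.
    by rewrite exprMn -scalerAl -scalerAr scalerA.
  exists u, (wsos w * k + g * wsos v + g * q * k); split=> //.
  by rewrite -eu; ring.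
- move=> f; exists [:: (1, f)], 0; split; first by rewrite /weights_ge0 /= ler01.
  by rewrite /wsos big_seq1 /= scale1r mulr0 addr0.
Qed.

(* The factors of [p] are included so that [ivt_for] passes to them; Rolle's
   theorem for [p] uses the property for a cofactor of [p^`()]. *)
Definition ivt_for (F : realFieldType) (p : {poly F}) : Prop :=
  p != 0 -> forall q, q %| p -> forall a b, a < b -> q.[a] * q.[b] < 0 ->
  exists2 c, a < c < b & root q c.

Lemma homo_sgz (F K : realFieldType) (i : {rmorphism F -> K}) :
  (forall x, 0 <= x -> 0 <= i x) -> forall x, sgz (i x) = sgz x.
Proof.
move=> i0 x; have [x0|x0|->] := ltrgt0P x; last by rewrite rmorph0 !sgz0.
- by rewrite !gtr0_sgz // lt0r fmorph_eq0 gt_eqF // i0 // ltW.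
- rewrite !ltr0_sgz // -oppr_gt0 -rmorphN lt0r fmorph_eq0 oppr_eq0 lt_eqF //.
  by rewrite i0 // oppr_ge0 ltW.
Qed.

Lemma rmorph_poly_horner (D K : comNzRingType) (a : {rmorphism {poly D} -> K})
    (p : {poly D}) :
  (map_poly (a \o polyC) p).[a 'X] = a p.
Proof.
rewrite -[p in RHS]coefK poly_def rmorph_sum /=.
rewrite (horner_coef_wide _ (size_poly _ _)); apply: eq_bigr => k _.
by rewrite coef_map -mul_polyC rmorphM rmorphXn.
Qed.

(* Clearing the roots of [q] in [F] leaves a factor that still changes sign, so
   that the root adjoined is not in [F]. *)
Lemma adjoin_new_root (F : realFieldType) (p q : {poly F}) a b :
  q %| p -> a < b -> q.[a] * q.[b] < 0 -> (forall c, a < c < b -> ~~ root q c) ->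
  exists (K : realFieldType) (i : {rmorphism F -> K}) (c : K),
    [/\ forall x, sgz (i x) = sgz x, root (map_poly i p) c & forall x, c != i x].
Proof.
move=> qp ab; have [n] := ubnP (size q); elim: n => // n IHn in q qp *.
rewrite ltnS => qn qab nroot.
(* A root [d] lies outside [[a, b]], so ['X - d%:P] has the same sign at [a] and [b], and dividing
   by it keeps the sign change. *)
have [[d qd]|noroot] := pselect (exists d, root q d).
  have [q2 qE] : exists q2, q = q2 * ('X - d%:P) by apply/factor_theorem.
  have q0 : q2 != 0.
    by apply: contraTneq qab => q20; rewrite qE q20 mul0r !horner0 mulr0 ltxx.
  apply: (IHn q2).
  - by apply: dvdp_trans qp; rewrite qE dvdp_mulr.
  - move: qn; rewrite qE size_mul // ?polyXsubC_eq0 // size_XsubC.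
    by rewrite addn2.
  - move: qab; rewrite qE !hornerM !hornerXsubC mulrACA => qab.
    have dab : 0 < (a - d) * (b - d).
      have [ad|ad|ad] := ltrgtP a d; last first.
      + by move: qab; rewrite ad subrr mul0r mulr0 ltxx.
      + by rewrite mulr_gt0 ?subr_gt0 // (lt_trans ad).
      + have [bd|bd|bd] := ltrgtP b d; last first.
        * by move: qab; rewrite bd subrr !mulr0 ltxx.
        * by move: (nroot d); rewrite ad bd => /(_ isT); rewrite qd.
        * by rewrite nmulr_rgt0 subr_lt0.
    by rewrite pmulr_llt0 in qab.
  - by move=> c cab; apply: contra (nroot c cab); rewrite qE rootM => ->.
(* The cone does not contain [-1], because [q] changes sign. The new root is the image of ['X]. *)
have [|K [i [_ iT]]] := @ordered_field_of_avoiding_cone _ 1 _ (wsos_cone q).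
  move=> r [w [g [w0 e]]].
  apply: (@wsos_not_multiple F a b q (- g) w qab w0).
  by rewrite mulrN -[1](expr1n _ (2 * r)) -[1 ^+ _]opprK e opprD addrC addrA subrr add0r.
pose j : {rmorphism F -> K} := i \o (@polyC F).
have j_sg x : sgz (j x) = sgz x.
  apply: homo_sgz => {}x x0; apply: iT.
  exists [:: (x, 1)], 0; rewrite /weights_ge0 /= x0; split=> //.
  by rewrite /wsos big_seq1 expr1n alg_polyC mulr0 addr0.
have iE (f : {poly F}) : (map_poly j f).[i 'X] = i f by apply: rmorph_poly_horner.
have qroot : i q = 0.
  apply/le_anti/andP; split; last first.
    by apply: iT; exists [::], 1; rewrite /wsos big_nil add0r mulr1.
  rewrite -oppr_ge0 -rmorphN; apply: iT; exists [::], (-1).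
  by rewrite /wsos big_nil add0r mulrN1.
exists K, j, (i 'X); split=> //.
  have /dvdpP [k ->] := qp.
  by rewrite rmorphM rootM [X in _ || X]/root iE qroot eqxx orbT.
move=> x; apply/negP => /eqP ix; apply: noroot; exists x.
rewrite /root -(fmorph_eq0 j) -horner_map -qroot -iE; exact/eqP/esym/(congr1 (horner _)).
Qed.

Lemma ivt_for_dvd (F : realFieldType) (p q : {poly F}) :
  p != 0 -> q %| p -> ivt_for p -> ivt_for q.
Proof. by move=> p0 qp ip _ d dq; apply: ip => //; apply: dvdp_trans qp. Qed.

(** Each failure of the property allows a new root of [p] to be adjoined, which happens only
    finitely often, as [p] has fewer roots than its size. *)
Lemma ivt_extension1 (F : realFieldType) (p : {poly F}) : p != 0 ->
  exists (K : realFieldType) (i : {rmorphism F -> K}),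
    (forall x, sgz (i x) = sgz x) /\ ivt_for (map_poly i p).
Proof.
move=> p0.
(* [rs] lists the roots found so far and [k] bounds the number still to come. *)
suff H k : forall (K : realFieldType) (i : {rmorphism F -> K}) (rs : seq K),
    (forall x, sgz (i x) = sgz x) -> uniq rs -> all (root (map_poly i p)) rs ->
    (size p <= k + size rs)%N ->
    exists (K : realFieldType) (i : {rmorphism F -> K}),
    (forall x, sgz (i x) = sgz x) /\ ivt_for (map_poly i p).
  by apply: (H (size p) F idfun [::]); rewrite ?addn0.
elim: k => [|k IHk] K i rs isg urs rrs.
  rewrite add0n leqNgt => /negP []; rewrite -(size_map_poly i).
  by apply: max_poly_roots => //; rewrite map_poly_eq0.
move=> sk.
have [|bad] := pselect (ivt_for (map_poly i p)); first by exists K, i.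
have [q [a [b [qp ab qab nroot]]]] : exists q a b,
    [/\ q %| map_poly i p, a < b, q.[a] * q.[b] < 0 & forall c, a < c < b -> ~~ root q c].
  apply: contrapT => nex; apply: bad => _ q qp a b ab qab.
  apply: contrapT => nc; apply: nex; exists q, a, b; split=> // c cab.
  by apply/negP => rc; apply: nc; exists c.
have [K' [j [c [jsg rc cnew]]]] := adjoin_new_root qp ab qab nroot.
have mapE : map_poly (j \o i : {rmorphism F -> K'}) p = map_poly j (map_poly i p).
  by rewrite -map_poly_comp.
apply: (IHk K' (j \o i : {rmorphism F -> K'}) (c :: map j rs)).
- by move=> x /=; rewrite jsg.
- rewrite /= map_inj_uniq ?urs ?andbT; last exact: fmorph_inj.
  by apply/negP => /mapP [x _ cx]; have := cnew x; rewrite cx eqxx.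
- rewrite mapE /= rc all_map; apply/allP => x xrs /=.
  by rewrite /= /root horner_map fmorph_eq0; apply: (allP rrs).
- by rewrite /= size_map addnS.
Qed.

(** One extension, made for the product of the nonzero members, serves the whole list, since the
    property passes to factors. *)
Lemma ivt_extension (F : realFieldType) (ps : seq {poly F}) :
  exists (K : realFieldType) (i : {rmorphism F -> K}),
    (forall x, sgz (i x) = sgz x) /\ forall p, p \in ps -> ivt_for (map_poly i p).
Proof.
pose P := \prod_(p <- ps | p != 0) p.
have P0 : P != 0 by rewrite prodf_seq_neq0; apply/allP => p _; apply/implyP.
have [K [i [isg iP]]] := ivt_extension1 P0.
exists K, i; split=> // p pps ip0.
have p0 : p != 0 by rewrite -(map_poly_eq0 i).
apply: ivt_for_dvd iP ip0; first by rewrite map_poly_eq0.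
by rewrite dvdp_map /P (big_rem p pps) /= p0 dvdp_mulr.
Qed.

Lemma ivt_for_rcf (F : rcfType) (p : {poly F}) : ivt_for p.
Proof.
move=> _ q _ a b ab qab.
have inab c : a <= c <= b -> root q c -> a < c < b.
  move=> /andP [ac cb] rc; rewrite !lt_neqAle ac cb !andbT.
  apply/andP; split; apply: contraTneq qab => cE.
    by move: rc; rewrite -cE => /rootP->; rewrite mul0r ltxx.
  by move: rc; rewrite cE => /rootP->; rewrite mulr0 ltxx.
have [qa|qa] := leP q.[a] 0; last first.
  have qb : q.[b] <= 0 by rewrite ltW // -(pmulr_rlt0 _ qa).
  have [|c cab rc] := @poly_ivt _ (- q) a b (ltW ab).
    by rewrite !hornerN oppr_le0 ltW //= oppr_ge0.
  by rewrite rootN in rc; exists c => //; apply: inab.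
have qb : 0 <= q.[b].
  rewrite leNgt; apply: contraTN qab => qb.
  by rewrite -leNgt mulr_le0 // ltW.
have [|c cab rc] := @poly_ivt _ q a b (ltW ab); first by rewrite qa qb.
by exists c => //; apply: inab.
Qed.

(** * Finite root sets, neighbours in a list and Rolle's theorem *)

Lemma all_roots (F : idomainType) (p : {poly F}) : p != 0 ->
  exists rs : seq F, forall x, root p x = (x \in rs).
Proof.
have [n] := ubnP (size p); elim: n => // n IHn in p *; rewrite ltnS => pn p0.
have [[d]|noroot] := pselect (exists d, root p d); last first.
  exists [::] => x; rewrite in_nil; apply/negP => px.
  by apply: noroot; exists x.
case/factor_theorem => q pE.
have q0 : q != 0 by apply: contraNneq p0 => q0; rewrite pE q0 mul0r.
have [|rs rsP] := IHn q _ q0.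
  by move: pn; rewrite pE size_mul ?polyXsubC_eq0 // size_XsubC addn2.
by exists (d :: rs) => x; rewrite pE rootM root_XsubC rsP in_cons orbC.
Qed.

Lemma left_neighbor (F : realFieldType) (s : seq F) t :
  (exists2 x, x \in s & x < t) ->
  exists l, [/\ l \in s, l < t & forall y, y \in s -> y < t -> y <= l].
Proof.
elim: s => [|z s IHs] [x]; first by rewrite in_nil.
have [[y ys yt]|no] := pselect (exists2 y, y \in s & y < t); last first.
  rewrite in_cons => /predU1P [->|xs] xt; last by case: no; exists x.
  exists z; split=> //; first by rewrite mem_head.
  move=> w; rewrite in_cons => /predU1P [->//|ws] wt; by case: no; exists w.
move=> xzs xt; have [|l [ls lt lmax]] := IHs; first by exists y.
have [zt|zt] := ltP z t; last first.
  exists l; split=> //; first by rewrite in_cons ls orbT.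
  move=> w; rewrite in_cons => /predU1P [->|]; last exact: lmax.
  by rewrite ltNge zt.
have [zl|lz] := leP z l.
  exists l; split=> //; first by rewrite in_cons ls orbT.
  by move=> w; rewrite in_cons => /predU1P [->//|]; apply: lmax.
exists z; split=> //; first by rewrite mem_head.
move=> w; rewrite in_cons => /predU1P [->//|ws] wt.
by rewrite ltW // (le_lt_trans _ lz) // lmax.
Qed.

Lemma right_neighbor (F : realFieldType) (s : seq F) t :
  (exists2 x, x \in s & t < x) ->
  exists r, [/\ r \in s, t < r & forall y, y \in s -> t < y -> r <= y].
Proof.
case=> x xs tx; have [|l [ls lt lmax]] := @left_neighbor F (map -%R s) (- t).
  by exists (- x); rewrite ?ltrN2 // mem_map //; apply: oppr_inj.
have ls' : - l \in s by rewrite -(mem_map (@oppr_inj F)) opprK.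
exists (- l); split=> //; first by rewrite ltrNr.
move=> y ys ty; rewrite lerNl; apply: lmax; rewrite ?ltrN2 //.
by rewrite mem_map //; apply: oppr_inj.
Qed.

(** The algebraic proof: [b] is moved to the first root after [a], powers of ['X - a%:P] and
    ['X - b%:P] are divided out of [p] and of its derivative, and the cofactor [r] left of the
    derivative changes sign. *)
Lemma rolle_ivt (F : realFieldType) (p : {poly F}) a b :
  ivt_for p -> ivt_for p^`() -> p^`() != 0 -> a < b -> root p a -> root p b ->
  exists2 c, a < c < b & root p^`() c.
Proof.
move=> pivt dpivt dp0; have p0 : p != 0.
  by apply: contraNneq dp0 => ->; rewrite deriv0.
move: b => b1 ab1 ra rb1.
have [rs rsP] := all_roots p0.
have [|b [brs ab bmin]] := @right_neighbor F rs a.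
  by exists b1; rewrite // -rsP.
have bb1 : b <= b1 by apply: bmin; rewrite // -rsP.
have noroot c : a < c < b -> ~~ root p c.
  move=> /andP [ac cb]; rewrite rsP; apply/negP => crs.
  by have := bmin c crs ac; rewrite leNgt cb.
suff [c /andP [ac cb] rc] : exists2 c, a < c < b & root p^`() c.
  by exists c; rewrite // ac (lt_le_trans cb).
have {brs} rb : root p b by rewrite rsP.
have [k [q1]] := multiplicity_XsubC p a; rewrite p0 /= => q1a pE1.
have q10 : q1 != 0 by apply: contraNneq q1a => ->; rewrite root0.
have [l [q]] := multiplicity_XsubC q1 b; rewrite q10 /= => qb qE.
have qa : ~~ root q a by apply: contra q1a; rewrite qE rootM => ->.
case: k pE1 => [|k] pE1.
  by move: ra; rewrite pE1 mulr1 (negPf q1a).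
case: l qE => [|l] qE.
  move: rb; rewrite pE1 qE mulr1 rootM (negPf qb) /= root_exp_XsubC.
  by rewrite gt_eqF.
have pE : p = q * ('X - b%:P) ^+ l.+1 * ('X - a%:P) ^+ k.+1 by rewrite pE1 qE.
pose r := (('X - b%:P) * k.+1%:R + ('X - a%:P) * l.+1%:R) * q
          + ('X - a%:P) * ('X - b%:P) * q^`().
have dpE : p^`() = r * (('X - b%:P) ^+ l * ('X - a%:P) ^+ k).
  rewrite pE !derivM !deriv_exp !derivXsubC !mul1r /= /r !exprS.
  rewrite -[_ *+ k.+1]mulr_natr -[_ *+ l.+1]mulr_natr.
  move: (k.+1%:R) (l.+1%:R) q^`() ('X - b%:P) ('X - a%:P) (_ ^+ l) (_ ^+ k).
  by move=> *; ring.
(* [q] has no root on the closed interval, so its values at the ends have the same sign. *)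
have qab : 0 < q.[a] * q.[b].
  rewrite lt_neqAle eq_sym mulf_neq0 //= leNgt; apply/negP => qab.
  have [|c cab rc] := pivt p0 q _ a b ab qab.
    by rewrite pE -mulrA dvdp_mulr.
  by move: (noroot c cab); rewrite pE -mulrA rootM rc.
suff rab : r.[a] * r.[b] < 0.
  have [|c cab rc] := dpivt dp0 r _ a b ab rab; first by rewrite dpE dvdp_mulr.
  by exists c; rewrite // dpE rootM rc.
have rE x : r.[x] = ((x - b) * k.+1%:R + (x - a) * l.+1%:R) * q.[x]
                    + (x - a) * (x - b) * q^`().[x].
  rewrite /r -!polyC_natr.
  by rewrite !(hornerD, hornerM, hornerN, hornerX, hornerC).
rewrite !rE !subrr !mul0r !mulr0 !mul0r !addr0 add0r.
have -> : (a - b) * k.+1%:R * q.[a] * ((b - a) * l.+1%:R * q.[b]) =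
  - ((b - a) ^+ 2 * (k.+1%:R * l.+1%:R) * (q.[a] * q.[b])) by ring.
rewrite oppr_lt0 mulr_gt0 // mulr_gt0 ?exprn_gt0 ?subr_gt0 //.
by rewrite -natrM ltr0n.
Qed.

(** * Matching sign tables of two ordered fields *)

Lemma ivt_sgz_eq (F : realFieldType) (p q : {poly F}) a b :
  ivt_for p -> p != 0 -> q %| p -> a < b ->
  (forall c, a <= c <= b -> ~~ root q c) -> sgz q.[a] = sgz q.[b].
Proof.
move=> pivt p0 qp ab nroot.
have qa : q.[a] != 0 by apply: nroot; rewrite lexx ltW.
have qb : q.[b] != 0 by apply: nroot; rewrite lexx ltW.
have qab : 0 < q.[a] * q.[b].
  rewrite lt_neqAle eq_sym mulf_neq0 //= leNgt; apply/negP => qab.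
  have [c /andP [ac cb] rc] := pivt p0 q qp a b ab qab.
  by have := nroot c; rewrite !ltW // rc => /(_ isT).
move: qa; have [qa|qa|->] := ltrgt0P q.[a]; rewrite ?eqxx // => _.
  by move: qab; rewrite (pmulr_rgt0 _ qa) => qb'; rewrite !gtr0_sgz.
by move: qab; rewrite (nmulr_rgt0 _ qa) => qb'; rewrite !ltr0_sgz.
Qed.

(** In [p = q * ('X - c%:P)] the factor [q] has no root from [a] to [b], so only the linear factor
    changes sign. *)
Lemma ivt_simple_root (F : realFieldType) (p : {poly F}) a b c :
  ivt_for p -> p != 0 -> ~~ root p^`() c -> root p c -> a < c < b ->
  (forall d, a <= d <= b -> root p d -> d = c) -> p.[a] * p.[b] < 0.
Proof.
move=> pivt p0 dpc /factor_theorem [q pE] /andP [ac cb] uniq_root.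
have qc : q.[c] != 0.
  move: dpc; rewrite pE derivM derivXsubC mulr1 /root hornerD hornerM hornerXsubC.
  by rewrite subrr mulr0 add0r.
have qab : sgz q.[a] = sgz q.[b].
  apply: (ivt_sgz_eq pivt p0); [by rewrite pE dvdp_mulr|exact: lt_trans cb|].
  move=> d dab; apply/negP => rd; have dc : d = c.
    by apply: uniq_root => //; rewrite pE rootM rd.
  by rewrite -dc (rootP rd) eqxx in qc.
rewrite pE !hornerM !hornerXsubC -sgz_lt0 !sgzM qab.
rewrite (ltr0_sgz (x := a - c)) ?subr_lt0 // (gtr0_sgz (x := b - c)) ?subr_gt0 //.
have : q.[b] != 0.
  rewrite -sgz_eq0 -qab sgz_eq0; apply/negP => qa.
  have ea : a = c.
    by apply: uniq_root; rewrite ?lexx ?(ltW (lt_trans ac cb)) // pE rootM /root qa.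
  by rewrite ea ltxx in ac.
by case: sgzP.
Qed.

Definition same_cut (F F' : realFieldType) (x t : F) (x' t' : F') : Prop :=
  (x < t) = (x' < t') /\ (t < x) = (t' < x').

(* A list of pairs relates finitely many points of two ordered fields; [t] and
   [t'] have the same position when they are the same listed point or lie in the
   same gap. *)
Definition same_pos (F F' : realFieldType) (s : seq (F * F')) t t' : Prop :=
  forall z, z \in s -> same_cut z.1 t z.2 t'.

(** This makes [s] the graph of an order isomorphism between two finite sets. *)
Definition order_matched (F F' : realFieldType) (s : seq (F * F')) : Prop :=
  forall w, w \in s -> same_pos s w.1 w.2.

Definition swap_pairs (F F' : eqType) (s : seq (F * F')) : seq (F' * F) :=
  [seq (z.2, z.1) | z <- s].

Lemma swap_pairsK (F F' : eqType) : cancel (@swap_pairs F F') (@swap_pairs F' F).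
Proof. by move=> s; rewrite /swap_pairs -map_comp map_id_in // => -[]. Qed.

Lemma mem_swap_pairs (F F' : eqType) (s : seq (F * F')) x y :
  ((y, x) \in swap_pairs s) = ((x, y) \in s).
Proof.
apply/mapP/idP => [[[x1 y1] zs [-> ->]] //|xys].
by exists (x, y).
Qed.

Lemma same_pos_swap (F F' : realFieldType) (s : seq (F * F')) t t' :
  same_pos s t t' -> same_pos (swap_pairs s) t' t.
Proof. by move=> st [y x]; rewrite mem_swap_pairs => /st [e1 e2]; split. Qed.

Lemma order_matched_swap (F F' : realFieldType) (s : seq (F * F')) :
  order_matched s -> order_matched (swap_pairs s).
Proof. by move=> ms [y x]; rewrite mem_swap_pairs => /ms /same_pos_swap. Qed.

Lemma same_cut_eq (F F' : realFieldType) (x t : F) (x' t' : F') :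
  same_cut x t x' t' -> (x == t) = (x' == t').
Proof. by case=> e1 e2; rewrite !eq_le !leNgt e1 e2. Qed.

(** For an unlisted [t], take the midpoint of the partners of its two neighbours, a partner shifted
    by 1 if there is only one neighbour, and 0 if there is none. *)
Lemma same_pos_exists (F F' : realFieldType) (s : seq (F * F')) t :
  order_matched s -> exists t', same_pos s t t'.
Proof.
move=> ms.
have [[w ws ->]|nt] := pselect (exists2 w, w \in s & t = w.1).
  by exists w.2; apply: ms.
have s1 z : z \in s -> z.1 \in unzip1 s by apply: map_f.
have neq z : z \in s -> (t < z.1) = ~~ (z.1 < t).
  move=> zs; rewrite -leNgt lt_neqAle; case: eqVneq => //= e.
  by case: nt; exists z.
have split t' : (forall z, z \in s -> z.1 < t -> z.2 < t') ->
    (forall z, z \in s -> t < z.1 -> t' < z.2) -> same_pos s t t'.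
  move=> lo hi z zs; have := neq z zs; have := lo z zs; have := hi z zs.
  rewrite /same_cut; case: (z.1 < t) => /= hi' lo' ez; rewrite ez in hi' *.
    by have /lt_gtF -> := lo' isT; rewrite lo'.
  by have /lt_gtF -> := hi' isT; rewrite hi'.
have [L|nL] := pselect (exists2 x, x \in unzip1 s & x < t).
- have [_ [/mapP [l ls ->] lt lmax]] := left_neighbor L.
  have lo t' z : l.2 < t' -> z \in s -> z.1 < t -> z.2 < t'.
    move=> lt' zs zt; have [e1 _] := ms z zs l ls.
    by apply: le_lt_trans lt'; rewrite leNgt -e1 -leNgt lmax ?s1.
  have [U|nU] := pselect (exists2 x, x \in unzip1 s & t < x).
  + have [_ [/mapP [r rs ->] tr rmin]] := right_neighbor U.
    have lr : l.2 < r.2 by have [<- _] := ms r rs l ls; apply: lt_trans tr.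
    exists ((l.2 + r.2) / 2); apply: split => z zs; first by apply: lo => //; lra.
    move=> tz.
    have rz : r.2 <= z.2.
      by have [_ e2] := ms z zs r rs; rewrite leNgt -e2 -leNgt rmin ?s1.
    lra.
  + exists (l.2 + 1); apply: split => z zs; first by apply: lo => //; lra.
    by move=> tz; case: nU; exists z.1 => //; apply: s1.
- have [U|nU] := pselect (exists2 x, x \in unzip1 s & t < x).
  + have [_ [/mapP [r rs ->] tr rmin]] := right_neighbor U.
    exists (r.2 - 1); apply: split => z zs.
      by move=> zt; case: nL; exists z.1 => //; apply: s1.
    move=> tz; have rz : r.2 <= z.2.
      by have [_ e2] := ms z zs r rs; rewrite leNgt -e2 -leNgt rmin ?s1.
    lra.
  + exists 0; apply: split => z zs zt.
      by case: nL; exists z.1 => //; apply: s1.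
    by case: nU; exists z.1 => //; apply: s1.
Qed.

(** The sign tables of [p] and [p'] agree, their columns being the points and the gaps of [s]. *)
Definition sgz_matched (F F' : realFieldType) (s : seq (F * F'))
    (p : {poly F}) (p' : {poly F'}) : Prop :=
  forall t t', same_pos s t t' -> sgz p.[t] = sgz p'.[t'].

Lemma sgz_matched_swap (F F' : realFieldType) (s : seq (F * F')) p p' :
  sgz_matched s p p' -> sgz_matched (swap_pairs s) p' p.
Proof.
by move=> sp t' t /same_pos_swap; rewrite swap_pairsK => /sp ->.
Qed.

Lemma sgz_matched_root (F F' : realFieldType) (s : seq (F * F')) p p' t t' :
  sgz_matched s p p' -> same_pos s t t' -> root p t = root p' t'.
Proof. by move=> sp /sp e; rewrite /root -sgz_eq0 e sgz_eq0. Qed.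

(** The sign is constant on a gap, so a root in a gap would make [p] vanish on all of it; but points
    just to the right of the root are no roots. *)
Lemma mem_root_matched (F F' : realFieldType) (s : seq (F * F')) p p' t :
  order_matched s -> sgz_matched s p p' -> p != 0 -> root p t ->
  exists2 z, z \in s & z.1 = t.
Proof.
move=> ms sp p0 rt; apply: contrapT => nt.
have [t' tt'] := same_pos_exists t ms.
have rt' : root p' t' by rewrite -(sgz_matched_root sp tt').
have [rs rsP] := all_roots p0.
suff [u tu [uE us]] : exists2 u, t < u & u \notin rs /\ same_pos s u t'.
  by move: uE; rewrite -rsP (sgz_matched_root sp us) rt'.
have key u : t < u -> (forall x, x \in rs ++ unzip1 s -> t < x -> u < x) ->
    exists2 u, t < u & u \notin rs /\ same_pos s u t'.
  move=> tu umin; exists u => //; split.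
    apply/negP => urs; have := umin u.
    by rewrite mem_cat urs ltxx => /(_ isT tu).
  move=> z zs; have [e1 e2] := tt' z zs; rewrite /same_cut -e1 -e2.
  have z1 : z.1 \in rs ++ unzip1 s by rewrite mem_cat map_f ?orbT.
  have [zt|tz|zt] := ltgtP z.1 t.
  - by rewrite (lt_trans zt tu) (lt_gtF (lt_trans zt tu)).
  - by have uz := umin _ z1 tz; rewrite uz (lt_gtF uz).
  - by case: nt; exists z.
have [U|nU] := pselect (exists2 x, x \in rs ++ unzip1 s & t < x).
  have [r [_ tr rmin]] := right_neighbor U.
  apply: (key ((t + r) / 2)); first lra.
  by move=> x xs tx; have := rmin x xs tx; lra.
apply: (key (t + 1)); first lra.
by move=> x xs tx; case: nU; exists x.
Qed.

Lemma exists_upper_bound (F : realFieldType) (s : seq F) :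
  exists B, forall x, x \in s -> x < B.
Proof.
elim: s => [|y s [B sB]]; first by exists 0 => x; rewrite in_nil.
exists (Num.max (y + 1) B) => x; rewrite in_cons lt_max => /predU1P [->|/sB ->].
  by rewrite ltrDl ltr01.
by rewrite orbT.
Qed.

Lemma order_matched_sub (F F' : realFieldType) (s1 s : seq (F * F')) :
  {subset s1 <= s} -> order_matched s -> order_matched s1.
Proof. by move=> s1s ms w /s1s /ms sw z /s1s /sw. Qed.

(** The partner of the zero polynomial vanishes everywhere, even beyond the last of its roots if it
    had finitely many. *)
Lemma sgz_matched_eq0 (F F' : realFieldType) (s : seq (F * F')) p p' :
  order_matched s -> sgz_matched s p p' -> (p == 0) = (p' == 0).
Proof.
suff H (G G' : realFieldType) (r : seq (G * G')) q q' :
    order_matched r -> sgz_matched r q q' -> q = 0 -> q' = 0.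
  move=> ms sp; apply/eqP/eqP; first exact: H sp.
  exact: H (order_matched_swap ms) (sgz_matched_swap sp).
move=> mr rq q0; apply: contrapT => /eqP q'0.
have [rs rsP] := all_roots q'0.
have [t' /(_ t')] := exists_upper_bound rs.
have [t tt'] := same_pos_exists t' (order_matched_swap mr).
rewrite -rsP (sgz_matched_root (sgz_matched_swap rq) tt') q0 root0 ltxx.
by move=> /(_ isT).
Qed.

(* Points that are not roots of the list can be dropped, by the intermediate
   value property. *)
Lemma prune_matched (F F' : realFieldType) (s : seq (F * F'))
    (ps : seq ({poly F} * {poly F'})) :
  order_matched s -> (forall pp, pp \in ps -> sgz_matched s pp.1 pp.2) ->
  (forall pp, pp \in ps -> ivt_for pp.2) ->
  exists s1, [/\ {subset s1 <= s},
    forall pp, pp \in ps -> sgz_matched s1 pp.1 pp.2 &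
    forall z, z \in s1 -> exists2 pp, pp \in ps & (pp.1 != 0) && root pp.1 z.1].
Proof.
move=> ms sps psivt.
pose s1 := [seq z <- s | has (fun pp => (pp.1 != 0) && root pp.1 z.1) ps].
exists s1; split; first by move=> z; rewrite mem_filter => /andP [].
  move=> [p p'] pps t t' tt'.
  (* [u'] corresponds to [t] under all of [s]. It has the same position as [t'] relative to [s1],
     which keeps all roots of [p'], so [p'] has the same sign at both. *)
  have [u' tu'] := same_pos_exists t ms.
  rewrite (sps _ pps _ _ tu') /=.
  have [->|p'0] := eqVneq p' 0; first by rewrite !horner0.
  have sp := sps _ pps.
  have cut z : z \in s1 -> same_cut z.2 u' z.2 t'.
    move=> zs1; have [e1 e2] := tt' z zs1.
    move: zs1; rewrite mem_filter => /andP [_ zs].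
    by have [e3 e4] := tu' z zs; split; rewrite -?e1 -?e2 -?e3 -?e4.
  have noroot x y : (forall z, z \in s1 -> same_cut z.2 x z.2 y) ->
      x < y -> forall c, x <= c <= y -> ~~ root p' c.
    move=> xy_cut xy c /andP [xc cy]; apply/negP => rc.
    have [_ /mapP [z zs ->] /= zc] := mem_root_matched
      (order_matched_swap ms) (sgz_matched_swap sp) p'0 rc.
    have rz : root p z.1.
      by rewrite (sgz_matched_root sp (ms z zs)) zc.
    have zs1 : z \in s1.
      rewrite mem_filter zs andbT; apply/hasP; exists (p, p') => //=.
      by rewrite (sgz_matched_eq0 ms sp) p'0.
    have [e1 e2] := xy_cut z zs1; rewrite zc in e1 e2.
    have cx : c = x by apply/le_anti; rewrite xc leNgt e2 ltNge cy.
    by move: e1; rewrite cx ltxx xy.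
  have [ut|tu|->//] := ltgtP u' t'.
    apply: (ivt_sgz_eq (psivt _ pps)) => //=; exact: noroot ut.
  apply/esym/(ivt_sgz_eq (psivt _ pps)) => //=; apply: noroot tu => z zs1.
  by have [e1 e2] := cut z zs1; split; rewrite ?e1 ?e2.
move=> z; rewrite mem_filter => /andP [/hasP [pp pps ppz] _].
by exists pp.
Qed.

Lemma sgz_right_neighbor (F : realFieldType) (p : {poly F}) (s : seq F) t r :
  ivt_for p -> p != 0 -> (forall c, root p c -> c \in s) -> t \notin s ->
  t < r -> (forall y, y \in s -> t < y -> r <= y) -> ~~ root p r ->
  sgz p.[t] = sgz p.[r].
Proof.
move=> pivt p0 roots ts tr rmin nr.
apply: (ivt_sgz_eq pivt) => // c /andP [tc cr]; apply/negP => rc.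
have cs := roots c rc.
have tc' : t < c.
  by rewrite lt_neqAle tc andbT; apply: contraNneq ts => ->.
have rc' := rmin c cs tc'.
by move: nr; rewrite (_ : r = c) ?rc //; apply/le_anti; rewrite rc' cr.
Qed.

Lemma sgz_left_neighbor (F : realFieldType) (p : {poly F}) (s : seq F) t l :
  ivt_for p -> p != 0 -> (forall c, root p c -> c \in s) -> t \notin s ->
  l < t -> (forall y, y \in s -> y < t -> y <= l) -> ~~ root p l ->
  sgz p.[t] = sgz p.[l].
Proof.
move=> pivt p0 roots ts lt lmax nl.
apply/esym/(ivt_sgz_eq pivt) => // c /andP [lc ct]; apply/negP => rc.
have cs := roots c rc.
have ct' : c < t.
  by rewrite lt_neqAle ct andbT; apply: contraNneq ts => <-.
have cl := lmax c cs ct'.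
by move: nl; rewrite (_ : l = c) ?rc //; apply/le_anti; rewrite cl lc.
Qed.

(* Between two neighbours in [s], [p] has at most one root, a simple one, whose
   existence is decided by the signs of [p] at the neighbours. *)
Definition bracketed (F : realFieldType) (s : seq F) (p : {poly F}) : Prop :=
  [/\ ivt_for p, ivt_for p^`(), p^`() != 0, forall c, root p^`() c -> c \in s &
   exists lo hi, [/\ lo \in s, hi \in s, ~~ root p lo, ~~ root p hi &
     forall c, c \in s \/ root p c -> lo <= c <= hi]].

Lemma bracketed_rolle (F : realFieldType) (s : seq F) p a b :
  bracketed s p -> a < b -> root p a -> root p b -> exists2 c, a < c < b & c \in s.
Proof.
case=> pivt divt d0 roots _ ab ra rb.
have [c cab rc] := rolle_ivt pivt divt d0 ab ra rb.
by exists c => //; apply: roots.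
Qed.

Lemma deriv_neq0_neq0 (F : realFieldType) (p : {poly F}) : p^`() != 0 -> p != 0.
Proof. by apply: contraNneq => ->; rewrite deriv0. Qed.

(** An unlisted root [c] is the only root between its listed neighbours, by Rolle, and it is simple,
    as roots of the derivative are listed. So [p] changes sign between the neighbours, hence [p']
    between their partners. *)
Lemma root_transport (F F' : realFieldType) (s : seq (F * F')) p p' c :
  order_matched s -> bracketed (unzip1 s) p -> ivt_for p' -> p' != 0 ->
  (forall z, z \in s -> sgz p.[z.1] = sgz p'.[z.2]) -> root p c ->
  exists2 c', root p' c' & same_pos s c c'.
Proof.
move=> ms br p'ivt p'0 sp rc.
have [pivt divt d0 droots [lo [hi [los his nlo nhi bounds]]]] := br.
have p0 := deriv_neq0_neq0 d0.
have [[z zs zc]|nc] := pselect (exists2 z, z \in s & z.1 = c).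
  exists z.2; last by rewrite -zc; apply: ms.
  by rewrite /root -sgz_eq0 -sp // sgz_eq0 zc.
have /andP [loc chi] : lo <= c <= hi by apply: bounds; right.
have [|_ [/mapP [l ls ->] lc lmax]] := @left_neighbor _ (unzip1 s) c.
  exists lo; rewrite // lt_neqAle loc andbT.
  by apply: contraNneq nlo => ->.
have [|_ [/mapP [r rs ->] cr rmin]] := @right_neighbor _ (unzip1 s) c.
  exists hi; rewrite // lt_neqAle chi andbT.
  by apply: contraNneq nhi => <-.
have only d : l.1 <= d <= r.1 -> root p d -> d = c.
  move=> /andP [ld dr] rd; have [dc|cd|//] := ltgtP d c.
    have [e /andP [de ec] es] := bracketed_rolle br dc rd rc.
    by have := lmax e es ec; rewrite leNgt (le_lt_trans ld de).
  have [e /andP [ce ed] es] := bracketed_rolle br cd rc rd.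
  by have := rmin e es ce; rewrite leNgt (lt_le_trans ed dr).
have plr : p.[l.1] * p.[r.1] < 0.
  apply: (ivt_simple_root pivt p0 _ rc) => //; last by rewrite lc cr.
  by apply/negP => /droots /mapP [z zs cz]; apply: nc; exists z.
have lr : l.2 < r.2 by have [<- _] := ms r rs l ls; apply: lt_trans cr.
have p'lr : p'.[l.2] * p'.[r.2] < 0.
  by rewrite -sgz_lt0 sgzM -!sp // -sgzM sgz_lt0.
have [c' /andP [lc' cr'] rc'] := p'ivt p'0 p' (dvdpp _) _ _ lr p'lr.
exists c' => // z zs.
have z1s : z.1 \in unzip1 s by apply: map_f.
have [zc|cz|zc] := ltgtP z.1 c; last by case: nc; exists z.
  have zl : z.2 <= l.2.
    by have [e1 _] := ms z zs l ls; rewrite leNgt -e1 -leNgt lmax.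
  by rewrite /same_cut zc (lt_gtF zc) (le_lt_trans zl lc') (lt_gtF (le_lt_trans zl lc')).
have rz : r.2 <= z.2.
  by have [_ e2] := ms z zs r rs; rewrite leNgt -e2 -leNgt rmin.
by rewrite /same_cut cz (lt_gtF cz) (lt_le_trans cr' rz) (lt_gtF (lt_le_trans cr' rz)).
Qed.

(** By Rolle a listed point separates [c] from [d]; its partner separates [c'] from [d']. *)
Lemma root_order (F F' : realFieldType) (s : seq (F * F')) p c d c' d' :
  bracketed (unzip1 s) p -> root p c -> root p d ->
  same_pos s c c' -> same_pos s d d' -> c < d -> c' < d'.
Proof.
move=> br rc rd cc' dd' cd.
have [e /andP [ce ed] /mapP [z zs eE]] := bracketed_rolle br cd rc rd.
have [_ e2] := cc' z zs; have [e3 _] := dd' z zs.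
by apply: (@lt_trans _ _ z.2); rewrite -?e2 -?e3 -eE.
Qed.

Lemma bracketed_swap (F F' : realFieldType) (s : seq (F * F')) p :
  bracketed (unzip2 s) p -> bracketed (unzip1 (swap_pairs s)) p.
Proof. by rewrite /swap_pairs /unzip1 -map_comp. Qed.

Lemma same_cutC (F F' : realFieldType) (x t : F) (x' t' : F') :
  same_cut x t x' t' -> same_cut t x t' x'.
Proof. by case. Qed.

(** The roots of [p] are added, paired with those of [p']. In a gap the sign is read off at an
    adjacent listed point that is not a root; one exists, since by Rolle a point of [s] separates
    any two roots. *)
Lemma add_polynomial (F F' : realFieldType) (s : seq (F * F')) p p' :
  order_matched s -> bracketed (unzip1 s) p -> bracketed (unzip2 s) p' ->
  (forall z, z \in s -> sgz p.[z.1] = sgz p'.[z.2]) ->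
  exists s', [/\ {subset s <= s'}, order_matched s' & sgz_matched s' p p'].
Proof.
move=> ms br br' sp.
have [pivt divt d0 droots [lo [hi [los his nlo nhi bounds]]]] := br.
have [p'ivt d'ivt d'0 d'roots _] := br'.
have p0 := deriv_neq0_neq0 d0; have p'0 := deriv_neq0_neq0 d'0.
have ms' := order_matched_swap ms; have brs := bracketed_swap br'.
have root1 c : root p c -> exists2 c', root p' c' & same_pos s c c'.
  exact: root_transport ms br p'ivt p'0 sp.
have root2 c' : root p' c' -> exists2 c, root p c & same_pos s c c'.
  move=> rc'; have [|c rc cc'] := root_transport ms' brs pivt p0 _ rc'.
    by move=> [y x]; rewrite mem_swap_pairs => /sp /= ->.
  by exists c => //; have := same_pos_swap cc'; rewrite swap_pairsK.
have order c d c' d' : root p c -> root p d -> root p' c' -> root p' d' ->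
    same_pos s c c' -> same_pos s d d' -> (c < d) = (c' < d').
  move=> rc rd rc' rd' cc' dd'; apply/idP/idP; first exact: root_order br _ _ _ _.
  exact: root_order brs rc' rd' (same_pos_swap cc') (same_pos_swap dd').
have [rs rsP] := all_roots p0.
have /choice [f fP] : forall c, exists c', root p c -> root p' c' /\ same_pos s c c'.
  move=> c; have [rc|nc] := boolP (root p c); last by exists 0.
  by have [c' rc' cc'] := root1 c rc; exists c'.
pose s' := s ++ [seq (c, f c) | c <- rs].
have s'P z : z \in s' -> z \in s \/ root p z.1 /\ root p' z.2 /\ same_pos s z.1 z.2.
  rewrite mem_cat => /orP [|/mapP [c crs ->]]; [by left|right].
  by rewrite -rsP in crs; have [] := fP c crs.
have ss' z : z \in s -> z \in s' by rewrite mem_cat => ->.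
have ms'' : order_matched s'.
  move=> w ws' z zs'.
  have [zs|[rz [rz' zz]]] := s'P z zs'; have [ws|[rw [rw' ww]]] := s'P w ws'.
  - exact: ms.
  - exact: ww.
  - exact/same_cutC/zz.
  - by split; apply: order.
have sp' z : z \in s' -> sgz p.[z.1] = sgz p'.[z.2].
  case/s'P => [/sp //|[/rootP -> [/rootP -> _]]]; by rewrite !sgz0.
have roots1 c : root p c -> c \in unzip1 s'.
  by move=> rc; rewrite /unzip1 map_cat mem_cat -map_comp map_id -rsP rc orbT.
have roots2 c' : root p' c' -> c' \in unzip2 s'.
  move=> rc'; have [c rc cc'] := root2 c' rc'.
  have [rfc cfc] := fP c rc.
  have -> : c' = f c.
    by apply/le_anti; rewrite !leNgt -(order c c) // -(order c c) // ltxx.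
  by rewrite /unzip2 map_cat mem_cat -map_comp map_f ?orbT // -rsP.
exists s'; split=> // t t' tt'.
have [[z zs' zt]|nt] := pselect (exists2 z, z \in s' & z.1 = t).
  have /esym/eqP zt' := same_cut_eq (tt' z zs'); rewrite zt eqxx in zt'.
  by rewrite -zt -zt' sp'.
have nt1 : t \notin unzip1 s'.
  by apply/negP => /mapP [z zs' zt]; apply: nt; exists z.
have nt2 : t' \notin unzip2 s'.
  apply/negP => /mapP [z zs' zt]; apply: nt; exists z => //.
  by apply/eqP; rewrite (same_cut_eq (tt' z zs')) zt.
have [[r [rs' tr rmin nr]]|noR] := pselect (exists r, [/\ r \in s', t < r.1,
    forall y, y \in unzip1 s' -> t < y -> r.1 <= y & ~~ root p r.1]).
  rewrite (sgz_right_neighbor pivt p0 roots1 nt1 tr) // sp' //; apply/esym.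
  have [_ e2] := tt' r rs'.
  apply: (sgz_right_neighbor p'ivt p'0 roots2 nt2); rewrite -?e2 //.
    move=> _ /mapP [z zs' ->] tz; have [_ e4] := tt' z zs'.
    have [_ e6] := ms'' z zs' r rs'.
    by rewrite leNgt -e6 -leNgt rmin ?map_f // e4.
  by rewrite /root -sgz_eq0 -sp' // sgz_eq0.
have [[l [ls' lt lmax nl]]|noL] := pselect (exists l, [/\ l \in s', l.1 < t,
    forall y, y \in unzip1 s' -> y < t -> y <= l.1 & ~~ root p l.1]).
  rewrite (sgz_left_neighbor pivt p0 roots1 nt1 lt) // sp' //; apply/esym.
  have [e1 _] := tt' l ls'.
  apply: (sgz_left_neighbor p'ivt p'0 roots2 nt2); rewrite -?e1 //.
    move=> _ /mapP [z zs' ->] tz; have [e3 _] := tt' z zs'.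
    have [e5 _] := ms'' z zs' l ls'.
    by rewrite leNgt -e5 -leNgt lmax ?map_f // e3.
  by rewrite /root -sgz_eq0 -sp' // sgz_eq0.
have rootR r : r \in s' -> t < r.1 ->
    (forall y, y \in unzip1 s' -> t < y -> r.1 <= y) -> root p r.1.
  by move=> rs' tr rmin; apply: contrapT => /negP nr; apply: noR; exists r.
have rootL l : l \in s' -> l.1 < t ->
    (forall y, y \in unzip1 s' -> y < t -> y <= l.1) -> root p l.1.
  by move=> ls' lt lmax; apply: contrapT => /negP nl; apply: noL; exists l.
have bounds' y : y \in unzip1 s' -> lo <= y <= hi.
  move=> /mapP [z /s'P [zs|[rz _]] ->]; apply: bounds; [left|by right].
  exact: map_f.
have sub1 y : y \in unzip1 s -> y \in unzip1 s'.
  by move=> /mapP [z /ss' zs' ->]; apply: map_f.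
have [/mapP [hz hzs' hE] /mapP [lz lzs' lE]] := (sub1 _ his, sub1 _ los).
(* Above [hi], the left neighbour of [t] would be the non-root [hi], a case already settled;
   likewise below [lo]. So [t] has neighbours on both sides. *)
have thi : t < hi.
  rewrite ltNge; apply/negP => hit; move: (nhi); rewrite hE rootL // -hE.
    rewrite lt_neqAle hit andbT; apply: contraNneq nt1 => <-.
    exact: sub1.
  by move=> y /bounds' /andP [].
have lot : lo < t.
  rewrite ltNge; apply/negP => tlo; move: (nlo); rewrite lE rootR // -lE.
    rewrite lt_neqAle tlo andbT; apply: contraNneq nt1 => ->.
    exact: sub1.
  by move=> y /bounds' /andP [].
have [|_ [/mapP [l ls' ->] lt lmax]] := @left_neighbor _ (unzip1 s') t.
  by exists lo; rewrite ?sub1.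
have [|_ [/mapP [r rs' ->] tr rmin]] := @right_neighbor _ (unzip1 s') t.
  by exists hi; rewrite ?sub1.
have [e /andP [le er] es] := bracketed_rolle br (lt_trans lt tr)
  (rootL l ls' lt lmax) (rootR r rs' tr rmin).
have [et|te|et] := ltgtP e t.
- by have := lmax e (sub1 _ es) et; rewrite leNgt le.
- by have := rmin e (sub1 _ es) te; rewrite leNgt er.
- by move: nt1; rewrite -et sub1.
Qed.

Lemma sgz_lead_coef_far (F : realFieldType) (p : {poly F}) : p != 0 ->
  exists B, forall x, B <= x -> sgz p.[x] = sgz (lead_coef p).
Proof.
move=> p0; have := p0; rewrite -lead_coef_eq0.
have [l0|l0|->] := ltrgt0P (lead_coef p); rewrite ?eqxx // => _.
  have [B pB] := poly_pinfty_gt_lc l0; exists B => x Bx.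
  by rewrite !gtr0_sgz // (lt_le_trans l0) // pB.
have [|B pB] := @poly_pinfty_gt_lc _ (- p); first by rewrite lead_coefN oppr_gt0.
exists B => x /pB; rewrite lead_coefN hornerN lerN2 => px.
by rewrite !ltr0_sgz // (le_lt_trans px).
Qed.

(** The behaviour at minus infinity comes from the leading coefficient of [p \Po (- 'X)]. *)
Lemma sgz_far (F : realFieldType) (p : {poly F}) (s : seq F) : p != 0 ->
  exists B, [/\ 0 < B, forall x, x \in s -> - B < x < B &
    forall x, B <= x -> sgz p.[x] = sgz (lead_coef p) /\
      sgz p.[- x] = sgz (lead_coef p) * (-1) ^+ (size p).-1].
Proof.
move=> p0; pose q := p \Po (- 'X).
have sX : size (- 'X : {poly F}) = 2 by rewrite size_polyN size_polyX.
have lq : lead_coef q = lead_coef p * (-1) ^+ (size p).-1.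
  by rewrite lead_coef_comp ?sX // lead_coefN lead_coefX.
have q0 : q != 0.
  by rewrite -lead_coef_eq0 lq mulf_eq0 lead_coef_eq0 signr_eq0 orbF.
have [B1 hB1] := sgz_lead_coef_far p0; have [B2 hB2] := sgz_lead_coef_far q0.
have [B3 hB3] := exists_upper_bound (0 :: s ++ map -%R s).
exists (Num.max B1 (Num.max B2 B3)); split.
- by rewrite !lt_max hB3 ?mem_head ?orbT.
- move=> x xs; rewrite ltrNl !lt_max !hB3 ?orbT // in_cons mem_cat.
    by rewrite xs orbT.
  by rewrite (map_f -%R xs) !orbT.
- move=> x; rewrite !ge_max => /and3P [/hB1 -> /hB2 e _]; split=> //.
  by move: e; rewrite lq sgzM sgzX sgzN1 /q horner_comp hornerN hornerX.
Qed.

(** Far points [- B] and [B] supply the ends [lo] and [hi] of [bracketed]; equal sizes and leading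
    coefficients of equal sign make the signs there agree. *)
Lemma add_polynomial_sgz (F F' : realFieldType) (s : seq (F * F'))
    (p : {poly F}) (p' : {poly F'}) :
  order_matched s -> ivt_for p -> ivt_for p' -> ivt_for p^`() -> ivt_for p'^`() ->
  p^`() != 0 -> p'^`() != 0 ->
  sgz_matched s p^`() p'^`() -> size p = size p' ->
  sgz (lead_coef p) = sgz (lead_coef p') ->
  (forall z, z \in s -> sgz p.[z.1] = sgz p'.[z.2]) ->
  exists s', [/\ {subset s <= s'}, order_matched s' & sgz_matched s' p p'].
Proof.
move=> ms pivt p'ivt divt d'ivt d0 d'0 sd size_eq lead_eq sp.
have p0 := deriv_neq0_neq0 d0; have p'0 := deriv_neq0_neq0 d'0.
have [B [B0 sB pB]] := sgz_far (unzip1 s) p0.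
have [B' [B'0 sB' pB']] := sgz_far (unzip2 s) p'0.
pose s1 := [:: (- B, - B'), (B, B') & s].
have ss1 : {subset s <= s1} by move=> z zs; rewrite !in_cons zs !orbT.
have s1P z : z \in s1 -> [\/ z = (- B, - B'), z = (B, B') | z \in s].
  rewrite !in_cons => /or3P [/eqP|/eqP|]; [exact: Or31|exact: Or32|exact: Or33].
have in1 z : z \in s -> (- B < z.1) * (z.1 < B) * (- B' < z.2) * (z.2 < B').
  move=> zs; have /andP [h1 h2] := sB _ (map_f fst zs).
  by have /andP [h3 h4] := sB' _ (map_f snd zs); rewrite h1 h2 h3 h4.
have BN : - B < B by lra.
have B'N : - B' < B' by lra.
have ms1 : order_matched s1.
  move=> w /s1P [->|->|ws] z /s1P [->|->|zs] /=; rewrite /same_cut /=.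
  - by rewrite !ltxx.
  - by rewrite BN B'N (lt_gtF BN) (lt_gtF B'N).
  - by rewrite !(in1 z zs) !(lt_gtF (in1 z zs).1.1.1) !(lt_gtF (in1 z zs).1.2).
  - by rewrite BN B'N (lt_gtF BN) (lt_gtF B'N).
  - by rewrite !ltxx.
  - by rewrite !(in1 z zs) !(lt_gtF (in1 z zs).1.1.2) !(lt_gtF (in1 z zs).2).
  - by rewrite !(in1 w ws) !(lt_gtF (in1 w ws).1.1.1) !(lt_gtF (in1 w ws).1.2).
  - by rewrite !(in1 w ws) !(lt_gtF (in1 w ws).1.1.2) !(lt_gtF (in1 w ws).2).
  - exact: ms.
have sp1 z : z \in s1 -> sgz p.[z.1] = sgz p'.[z.2].
  case/s1P => [->|->|/sp //] /=.
    by rewrite (pB _ (lexx B)).2 (pB' _ (lexx B')).2 lead_eq size_eq.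
  by rewrite (pB _ (lexx B)).1 (pB' _ (lexx B')).1 lead_eq.
have br (G : realFieldType) (q : {poly G}) (r : seq G) b : ivt_for q ->
    ivt_for q^`() -> q^`() != 0 -> (forall c, root q^`() c -> c \in r) ->
    0 < b -> (forall x, x \in r -> - b < x < b) ->
    (forall x, b <= x -> sgz q.[x] = sgz (lead_coef q) /\
      sgz q.[- x] = sgz (lead_coef q) * (-1) ^+ (size q).-1) ->
    bracketed [:: - b, b & r] q.
  move=> qivt dqivt dq0 droots b0 rb qb; split=> //.
    by move=> c rc; rewrite !in_cons droots ?orbT.
  have lq0 : sgz (lead_coef q) != 0.
    by rewrite sgz_eq0 lead_coef_eq0 deriv_neq0_neq0.
  have nroot x : b <= x -> ~~ root q x /\ ~~ root q (- x).
    move=> /qb [e1 e2]; rewrite /root -!(sgz_eq0 q.[_]) e1 e2.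
    by rewrite mulf_neq0 ?signr_eq0.
  exists (- b), b; rewrite !in_cons !eqxx orbT; split=> //.
  - by case: (nroot b (lexx b)).
  - by case: (nroot b (lexx b)).
  move=> c [|rc].
    rewrite !in_cons => /or3P [/eqP->|/eqP->|/rb /andP [/ltW -> /ltW ->]] //.
      by rewrite lexx /=; lra.
    by rewrite lexx andbT; lra.
  apply/andP; split; rewrite leNgt; apply/negP => bc.
    have [|_] := nroot (- c); first lra.
    by rewrite opprK rc.
  by have [] := nroot c (ltW bc); rewrite rc.
have droots c : root p^`() c -> c \in unzip1 s.
  by move=> rc; have [z zs <-] := mem_root_matched ms sd d0 rc; apply: map_f.
have d'roots c : root p'^`() c -> c \in unzip2 s.
  move=> rc; have [[y x] zs <-] := mem_root_matched (order_matched_swap ms)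
    (sgz_matched_swap sd) d'0 rc.
  by rewrite mem_swap_pairs in zs; apply: (map_f snd zs).
have [s' [s1s' ms' sp']] := add_polynomial ms1 (br _ _ _ _ pivt divt d0 droots B0 sB pB)
  (br _ _ _ _ p'ivt d'ivt d'0 d'roots B'0 sB' pB') sp1.
by exists s'; split=> // z /ss1 /s1s'.
Qed.

(** * Elimination of one variable *)

(* The extra power of the leading coefficient makes the total factor of [p] a
   square, so that signs are preserved at the roots of [t]. *)
Definition pseudo_rem (D : comNzRingType) (p t : {poly D}) : {poly D} :=
  lead_coef t ^+ Pdiv.Ring.rscalp p t *: Pdiv.Ring.rmodp p t.

Lemma size_pseudo_rem (D : comNzRingType) (p t : {poly D}) :
  t != 0 -> (size (pseudo_rem p t) < size t)%N.
Proof.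
move=> t0; apply: leq_ltn_trans (size_scale_leq _ _) _.
by rewrite Pdiv.Ring.ltn_rmodp.
Qed.

Lemma sgz_pseudo_rem (D : comNzRingType) (F : realFieldType) (a : {rmorphism D -> F})
    (p t : {poly D}) x :
  a (lead_coef t) != 0 -> root (map_poly a t) x ->
  sgz (map_poly a p).[x] = sgz (map_poly a (pseudo_rem p t)).[x].
Proof.
move=> at0 /rootP tx; rewrite /pseudo_rem.
have := Pdiv.ComRing.rdivp_eq t p; move: (Pdiv.Ring.rscalp p t) => k.
move: (Pdiv.Ring.rmodp p t) (Pdiv.Ring.rdivp p t) => r q e.
rewrite map_polyZ hornerZ rmorphXn.
have -> : (map_poly a r).[x] = a (lead_coef t) ^+ k * (map_poly a p).[x].
  move: (congr1 (fun f => (map_poly a f).[x]) e).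
  rewrite map_polyZ hornerZ rmorphXn rmorphD rmorphM /= hornerD hornerM tx.
  by rewrite mulr0 add0r.
rewrite mulrA sgzM -expr2 [sgz (_ ^+ 2)]gtr0_sgz ?mul1r //.
by rewrite exprn_even_gt0 // expf_neq0.
Qed.

(** A morphism may kill leading coefficients; a nonzero image of [q] is then the image of a
    truncation whose leading coefficient survives. *)
Definition truncations (D : nzRingType) (qs : seq {poly D}) : seq {poly D} :=
  flatten [seq [seq t <- [seq take_poly i q | i <- iota 0 (size q).+1] | t != 0]
          | q <- qs].

Lemma truncationsP (D : nzRingType) (qs : seq {poly D}) t :
  t \in truncations qs ->
  t != 0 /\ exists2 q, q \in qs & (size t <= size q)%N.
Proof.
case/flatten_mapP => q qqs; rewrite mem_filter => /andP [t0 /mapP [i iq tE]].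
split=> //; exists q => //; rewrite tE.
by apply: leq_trans (size_take_poly _ _) _; rewrite mem_iota in iq; rewrite -ltnS.
Qed.

Definition same_signs (D : nzRingType) (F F' : realFieldType)
    (a : D -> F) (a' : D -> F') (C : seq D) : Prop :=
  forall c, c \in C -> sgz (a c) = sgz (a' c).

(** Coefficients of equal sign vanish together, so cutting [q] at the size of its image under [a]
    suits [a'] as well. *)
Lemma same_truncation (D : comNzRingType) (F F' : realFieldType)
    (a : {rmorphism D -> F}) (a' : {rmorphism D -> F'}) (qs : seq {poly D}) q :
  q \in qs -> same_signs a a' q -> map_poly a q != 0 ->
  exists2 t, t \in truncations qs &
    [/\ map_poly a t = map_poly a q, map_poly a' t = map_poly a' q,
        a (lead_coef t) != 0 & a' (lead_coef t) != 0].
Proof.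
move=> qqs sq aq0; set i := size (map_poly a q).
have i0 : (0 < i)%N by rewrite size_poly_gt0.
have iq : (i <= size q)%N by apply: size_poly.
have acoef k : (i <= k)%N -> a q`_k = 0.
  by move=> ik; rewrite -coef_map nth_default.
have sgz_coef k : sgz (a q`_k) = sgz (a' q`_k).
  have [kq|kq] := ltnP k (size q); first by apply: sq; apply: mem_nth.
  by rewrite nth_default // !rmorph0 !sgz0.
have a'coef k : (i <= k)%N -> a' q`_k = 0.
  by move=> ik; apply/eqP; rewrite -sgz_eq0 -sgz_coef acoef // sgz0.
have al : a q`_i.-1 != 0.
  by rewrite -coef_map -/(lead_coef _) lead_coef_eq0.
have a'l : a' q`_i.-1 != 0 by rewrite -sgz_eq0 -sgz_coef sgz_eq0.
pose t := take_poly i q.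
have ti : t`_i.-1 = q`_i.-1 by rewrite coef_take_poly prednK // leqnn.
have t0 : t != 0.
  by apply: contraNneq al => t0; rewrite -ti t0 coef0 rmorph0.
have st : size t = i.
  apply/eqP; rewrite eqn_leq size_take_poly /= -[i]prednK // ltnNge.
  by apply: contraNN al => ti'; rewrite -ti nth_default // rmorph0.
have lt : lead_coef t = q`_i.-1 by rewrite lead_coefE st ti.
exists t.
  apply/flatten_mapP; exists q => //; rewrite mem_filter t0; apply/mapP.
  by exists i; rewrite // mem_iota ltnS.
split; rewrite ?lt //.
  apply/polyP => k; rewrite !coef_map coef_take_poly.
  by case: ltnP => // ik; exact: etrans (rmorph0 a) (esym (acoef k ik)).
apply/polyP => k; rewrite !coef_map coef_take_poly.
by case: ltnP => // ik; exact: etrans (rmorph0 a') (esym (a'coef k ik)).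
Qed.

Definition matched_by (D : comNzRingType) (F F' : realFieldType)
    (a : {rmorphism D -> F}) (a' : {rmorphism D -> F'}) (qs : seq {poly D})
    (s : seq (F * F')) : Prop :=
  order_matched s /\
  forall q, q \in qs -> sgz_matched s (map_poly a q) (map_poly a' q).

Definition ivt_all (D : comNzRingType) (F : realFieldType)
    (a : {rmorphism D -> F}) (qs : seq {poly D}) : Prop :=
  forall q, q \in qs -> ivt_for (map_poly a q).

Lemma sgz_matched_sub (F F' : realFieldType) (s s' : seq (F * F')) p p' :
  {subset s <= s'} -> sgz_matched s p p' -> sgz_matched s' p p'.
Proof. by move=> ss' sp t t' tt'; apply: sp => z /ss' /tt'. Qed.

(** After pruning, each listed point is a root of the derivative or of a member of [qs]; there [p]
    has the sign of a pseudo-remainder, already in the table. This is what [add_polynomial_sgz]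
    needs to add [p]. *)
Lemma elimination_step (D : comNzRingType) (F F' : realFieldType)
    (a : {rmorphism D -> F}) (a' : {rmorphism D -> F'}) (p : {poly D}) qs s :
  (1 < size p)%N -> a (lead_coef p) != 0 -> a' (lead_coef p) != 0 ->
  sgz (a (lead_coef p)) = sgz (a' (lead_coef p)) ->
  (forall q, q \in p^`() :: qs -> same_signs a a' q) ->
  ivt_all a [:: p, p^`() & qs] -> ivt_all a' [:: p, p^`() & qs] ->
  matched_by a a' (p^`() :: qs ++ map (pseudo_rem p) (truncations (p^`() :: qs))) s ->
  exists s', matched_by a a' (p :: qs) s'.
Proof.
move=> sp alp a'lp sgz_lp qs_sgz aivt a'ivt [ms sqs].
have [s1 [s1s s1qs s1root]] : exists s1, [/\ {subset s1 <= s},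
    forall q, q \in p^`() :: qs -> sgz_matched s1 (map_poly a q) (map_poly a' q) &
    forall z, z \in s1 -> exists2 q, q \in p^`() :: qs &
      (map_poly a q != 0) && root (map_poly a q) z.1].
  have [|||s1 [s1s s1qs s1root]] := @prune_matched F F' s
    [seq (map_poly a q, map_poly a' q) | q <- p^`() :: qs] => //.
  - move=> _ /mapP [q qqs ->]; apply: sqs; move: qqs.
    by rewrite !in_cons mem_cat => /predU1P [->|->]; rewrite ?eqxx ?orbT.
  - move=> _ /mapP [q qqs ->]; apply: a'ivt; move: qqs.
    by rewrite !in_cons => ->; rewrite orbT.
  exists s1; split=> //.
    by move=> q qqs; apply: (s1qs (_, _)); apply: map_f.
  by move=> z /s1root [_ /mapP [q qqs ->] rz]; exists q.
have ms1 := order_matched_sub s1s ms.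
have s1p z : z \in s1 -> sgz (map_poly a p).[z.1] = sgz (map_poly a' p).[z.2].
  move=> zs1; have [q qqs /andP [q0 rz]] := s1root z zs1.
  have [t tqs [atq a'tq at0 a't0]] := same_truncation qqs (qs_sgz q qqs) q0.
  have zz := ms z (s1s z zs1).
  rewrite (sgz_pseudo_rem p at0) ?atq // (sgz_pseudo_rem p a't0); last first.
    by rewrite a'tq -(sgz_matched_root (s1qs q qqs) (ms1 z zs1)).
  by apply: sqs zz; rewrite in_cons mem_cat map_f ?orbT.
have szp : size (map_poly a p) = size p by apply: size_map_poly_id0.
have szp' : size (map_poly a' p) = size p by apply: size_map_poly_id0.
have d0 : (map_poly a p)^`() != 0.
  by rewrite -size_poly_gt0 size_deriv szp -subn1 subn_gt0.
have d'0 : (map_poly a' p)^`() != 0.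
  by rewrite -size_poly_gt0 size_deriv szp' -subn1 subn_gt0.
have [|||||||s2 [s1s2 ms2 s2p]] :=
    @add_polynomial_sgz F F' s1 (map_poly a p) (map_poly a' p) ms1 _ _ _ _ d0 d'0 _ _ _ s1p.
- by apply: aivt; rewrite mem_head.
- by apply: a'ivt; rewrite mem_head.
- by rewrite deriv_map; apply: aivt; rewrite !in_cons eqxx orbT.
- by rewrite deriv_map; apply: a'ivt; rewrite !in_cons eqxx orbT.
- by rewrite !deriv_map; apply: s1qs; rewrite mem_head.
- by rewrite szp szp'.
- by rewrite !lead_coef_map_eq.
exists s2; split=> // q; rewrite in_cons => /predU1P [->//|qqs].
by apply: sgz_matched_sub s1s2 _; apply: s1qs; rewrite in_cons qqs orbT.
Qed.

(** [C] and [cl] come before the fields and morphisms, so they depend on [qs] alone; [cl] collects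
    the polynomials whose intermediate value property is called upon. *)
Definition eliminable (D : comNzRingType) (qs : seq {poly D}) : Prop :=
  exists (C : seq D) (cl : seq {poly D}),
  forall (F F' : realFieldType) (a : {rmorphism D -> F}) (a' : {rmorphism D -> F'}),
    ivt_all a cl -> ivt_all a' cl -> same_signs a a' C ->
    exists s, matched_by a a' qs s.

Lemma eliminable_sub (D : comNzRingType) (qs qs' : seq {poly D}) :
  {subset qs <= qs'} -> eliminable qs' -> eliminable qs.
Proof.
move=> sub [C [cl H]]; exists C, cl => F F' a a' h1 h2 h3.
have [s [ms sqs]] := H F F' a a' h1 h2 h3.
by exists s; split=> // q /sub /sqs.
Qed.

Lemma eliminable_const (D : comNzRingType) (qs : seq {poly D}) :
  all (fun q : {poly D} => size q <= 1)%N qs -> eliminable qs.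
Proof.
move=> /allP qs1; exists [seq q`_0 | q : {poly D} <- qs], [::] => F F' a a' _ _ sC.
exists [::]; split=> // q qqs t t' _.
have /size1_polyC qE := qs1 q qqs.
by rewrite qE !map_polyC !hornerC; apply: sC; apply: map_f.
Qed.

Lemma map_poly_take_lead (D : nzRingType) (F : nzRingType) (a : {rmorphism D -> F})
    (p : {poly D}) n :
  size p = n.+1 -> a (lead_coef p) = 0 -> map_poly a (take_poly n p) = map_poly a p.
Proof.
move=> sp ap; apply/polyP => k; rewrite !coef_map coef_take_poly.
have [//|kn] := ltnP; apply: etrans (rmorph0 a) _; apply: esym.
move: kn; rewrite leq_eqVlt => /predU1P [<-|nk].
  by rewrite -ap lead_coefE sp.
by rewrite nth_default ?sp //; apply: rmorph0.
Qed.

(* The new list replaces a polynomial of maximal degree by polynomials of smaller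
   degree: its truncation if the leading coefficient vanishes, its derivative and
   pseudo-remainders otherwise. *)
Lemma elimination (D : comNzRingType) (qs : seq {poly D}) : eliminable qs.
Proof.
have [d] : exists d, all (fun q : {poly D} => size q <= d.+1)%N qs.
  exists (\max_(q <- qs) size q); apply/allP => q qqs.
  by apply: leqW; apply: (@leq_bigmax_seq _ qs predT (fun q : {poly D} => size q)).
(* The induction is lexicographic: on the size bound, then on the number of polynomials that reach
   it. *)
elim: d qs => [|d IHd] qs; first exact: eliminable_const.
have [k] := ubnP (count (fun q : {poly D} => size q == d.+2) qs).
elim: k qs => // k IHk qs; rewrite ltnS => qsk qsd.
have [|/allPn [p pqs]] := boolP (all (fun q : {poly D} => size q <= d.+1)%N qs).
  exact: IHd.
rewrite -ltnNge => dp; have sp : size p = d.+2.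
  by apply/eqP; rewrite eqn_leq dp andbT; apply: (allP qsd).
have perm := perm_to_rem pqs.
set q0 := rem p qs in perm.
have q0d : all (fun q : {poly D} => size q <= d.+2)%N q0.
  by apply/allP => q qq0; apply: (allP qsd); rewrite (perm_mem perm) in_cons qq0 orbT.
have q0k : (count (fun q : {poly D} => size q == d.+2) q0 < k)%N.
  by apply: leq_trans qsk; rewrite (permP perm) /= sp eqxx.
have small (q : {poly D}) : (size q <= d.+1)%N -> (size q == d.+2) = false.
  by move=> sq; rewrite ltn_eqF.
have st : (size (take_poly d.+1 p) <= d.+1)%N by apply: size_take_poly.
have sd : (size p^`() <= d.+1)%N.
  by rewrite -ltnS -sp lt_size_deriv // -size_poly_gt0 sp.
have [CA [clA HA]] : eliminable (take_poly d.+1 p :: q0).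
  by apply: IHk; rewrite /= ?small // leqW.
have sr t : t \in truncations (p^`() :: q0) -> (size (pseudo_rem p t) <= d.+1)%N.
  move=> /truncationsP [t0 [q qqs tq]]; rewrite -ltnS.
  apply: leq_trans (size_pseudo_rem p t0) _; apply: leq_trans tq _.
  move: qqs; rewrite in_cons => /predU1P [->|/(allP q0d) //].
  exact: leqW.
have [CB [clB HB]] :
    eliminable (p^`() :: q0 ++ map (pseudo_rem p) (truncations (p^`() :: q0))).
  apply: IHk.
    rewrite /= small // add0n count_cat [X in (_ + X)%N](_ : _ = 0%N) ?addn0 //.
    apply/eqP; rewrite eqn0Ngt -has_count; apply/hasPn => _ /mapP [t tT ->].
    by rewrite small ?sr.
  rewrite /= leqW //= all_cat q0d; apply/allP => _ /mapP [t tT ->].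
  by rewrite leqW ?sr.
apply: (@eliminable_sub _ _ (p :: q0)); first by move=> q; rewrite (perm_mem perm).
(* The signs of these coefficients tell which truncations have the images of the polynomials. *)
pose coefs := flatten [seq polyseq q | q <- p^`() :: q0].
exists (lead_coef p :: coefs ++ CA ++ CB), ([:: p, p^`() & q0] ++ clA ++ clB).
move=> F F' a a' ia ia' sC.
have sublist (T : eqType) (r1 r2 r3 : seq T) :
    {subset r1 <= r1 ++ r2 ++ r3} /\ {subset r2 <= r1 ++ r2 ++ r3}
    /\ {subset r3 <= r1 ++ r2 ++ r3}.
  by split; [|split] => x xr; rewrite !mem_cat xr ?orbT.
have [icl [iA iB]] := sublist _ [:: p, p^`() & q0] clA clB.
have [iC [iCA iCB]] := sublist _ coefs CA CB.
have inC c : c \in coefs ++ CA ++ CB -> sgz (a c) = sgz (a' c).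
  by move=> cC; apply: sC; rewrite in_cons cC orbT.
have sl : sgz (a (lead_coef p)) = sgz (a' (lead_coef p)).
  by apply: sC; rewrite mem_head.
have [al0|al] := eqVneq (a (lead_coef p)) 0.
  have a'l0 : a' (lead_coef p) = 0.
    by apply/eqP; rewrite -sgz_eq0 -sl al0 sgz0.
  have [|||s [ms sqs]] := HA F F' a a'.
  - by move=> q /iA /ia.
  - by move=> q /iA /ia'.
  - by move=> c /iCA /inC.
  exists s; split=> // q; rewrite in_cons => /predU1P [->|qq0].
    rewrite -(map_poly_take_lead sp al0) -(map_poly_take_lead sp a'l0).
    by apply: sqs; rewrite mem_head.
  by apply: sqs; rewrite in_cons qq0 orbT.
have a'l : a' (lead_coef p) != 0 by rewrite -sgz_eq0 -sl sgz_eq0.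
have [|||s sB] := HB F F' a a'.
- by move=> q /iB /ia.
- by move=> q /iB /ia'.
- by move=> c /iCB /inC.
apply: (elimination_step _ al a'l sl _ _ _ sB); rewrite ?sp //.
- move=> q qqs c cq; apply: inC; apply: iC; apply/flattenP.
  by exists (polyseq q) => //; apply: map_f.
- by move=> q /icl /ia.
- by move=> q /icl /ia'.
Qed.

(** * Specialization and the Positivstellensatz *)

(** Signs of finitely many elements in any ordered field are realized at an [R]-point of [D], that
    is, a morphism to [R] fixing [R]. *)
Definition specializable (R : rcfType) (D : comNzRingType)
    (i : {rmorphism R -> D}) : Prop :=
  forall (K : realFieldType) (a : {rmorphism D -> K}) (C : seq D),
  exists b : {rmorphism D -> R}, (forall c, b (i c) = c) /\ same_signs a b C.

(** Nonnegative elements of [R] are squares, and morphisms send squares to squares. *)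
Lemma rcf_homo_sgz (R : rcfType) (K : realFieldType) (a : {rmorphism R -> K}) x :
  sgz (a x) = sgz x.
Proof.
apply: homo_sgz => {}x x0; rewrite -(sqr_sqrtr x0) rmorphXn.
exact: sqr_ge0.
Qed.

Lemma specializable_id (R : rcfType) : specializable (idfun : {rmorphism R -> R}).
Proof. by move=> K a C; exists idfun; split=> // c _; apply: rcf_homo_sgz. Qed.

(** [K] is enlarged to have the intermediate values that elimination needs. The coefficients are
    specialized by hypothesis, and ['X] goes to a point of [R] with the same position as its image
    in the enlarged field. *)
Lemma specializable_poly (R : rcfType) (D : comNzRingType) (i : {rmorphism R -> D}) :
  specializable i -> specializable (polyC \o i : {rmorphism R -> {poly D}}).
Proof.
move=> Di K a qs; have [C [cl elim]] := elimination qs.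
pose a0 : {rmorphism D -> K} := a \o polyC.
have [L [j [jsg jcl]]] := ivt_extension (map (map_poly a0) cl).
pose a1 : {rmorphism D -> L} := j \o a0.
have [b0 [b0i b0C]] := Di L a1 C.
have [||s [ms sqs]] := elim L R a1 b0 _ _ b0C.
- move=> q qcl; rewrite (map_poly_comp j a0).
  exact/jcl/map_f.
- by move=> q _; apply: ivt_for_rcf.
have [t' tt'] := same_pos_exists (j (a 'X)) ms.
have comm : commr_rmorph b0 t' by move=> x; apply: mulrC.
exists (horner_morph comm : {rmorphism {poly D} -> R}); split=> [c|q qqs].
  by rewrite /= horner_morphC b0i.
rewrite -[RHS]/(sgz (map_poly b0 q).[t']).
rewrite -(sqs q qqs _ _ tt') (map_poly_comp j a0) horner_map jsg.
by rewrite rmorph_poly_horner.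
Qed.

Lemma specializable_retract (R : rcfType) (D E : comNzRingType)
    (i : {rmorphism R -> D}) (k : {rmorphism R -> E})
    (f : {rmorphism E -> D}) (g : {rmorphism D -> E}) :
  (forall x, g (f x) = x) -> (forall c, f (k c) = i c) ->
  specializable i -> specializable k.
Proof.
move=> gf fk Di K a C; have [b [bi bC]] := Di K (a \o g) (map f C).
exists (b \o f); split=> [c|c cC] /=; first by rewrite fk.
by rewrite -bC ?map_f //= gf.
Qed.

Lemma mpoly_rmorph_ext (R : comNzRingType) n (S : comNzRingType)
    (f g : {rmorphism {mpoly R[n]} -> S}) :
  (forall c, f c%:MP = g c%:MP) -> (forall i, f 'X_i = g 'X_i) -> f =1 g.
Proof.
move=> fgC fgX p; rewrite [p]mpolyE !rmorph_sum; apply: eq_bigr => m _.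
rewrite -mul_mpolyC !rmorphM /= fgC; congr (_ * _).
rewrite mpolyXE_id !rmorph_prod; apply: eq_bigr => i _.
by rewrite !rmorphXn /= fgX.
Qed.

Lemma specializable_mpoly (R : rcfType) n :
  specializable (@mpolyC n R : {rmorphism R -> {mpoly R[n]}}).
Proof.
elim: n => [|n IHn].
  apply: (@specializable_retract R R _ idfun _
    (meval (fun _ : 'I_0 => 0) : {rmorphism {mpoly R[0]} -> R})
    (@mpolyC 0 R)); last exact: specializable_id.
  - pose h : {rmorphism {mpoly R[0]} -> {mpoly R[0]}} :=
      (@mpolyC 0 R) \o (meval (fun _ : 'I_0 => 0)).
    apply: (@mpoly_rmorph_ext _ _ _ h idfun) => [c|[]//].
    by rewrite /= mevalC.
  - by move=> c; rewrite /= mevalC.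
(* The last variable becomes the polynomial variable; [f] and [g] are the two directions of this
   identification. *)
pose h (i : 'I_n.+1) : {poly {mpoly R[n]}} :=
  if unlift ord_max i is Some j then ('X_j)%:P else 'X.
pose f : {rmorphism {mpoly R[n.+1]} -> {poly {mpoly R[n]}}} :=
  mmap (polyC \o @mpolyC n R) h.
pose w : {rmorphism {mpoly R[n]} -> {mpoly R[n.+1]}} :=
  mmap (@mpolyC n.+1 R) (fun j : 'I_n => 'X_(lift ord_max j)).
have comm : commr_rmorph w ('X_ord_max) by move=> x; apply: mulrC.
pose g : {rmorphism {poly {mpoly R[n]}} -> {mpoly R[n.+1]}} := horner_morph comm.
apply: (specializable_retract (f := f) (g := g) _ _ (specializable_poly IHn)).
- apply: (@mpoly_rmorph_ext _ _ _ (g \o f) idfun) => [c|i] /=.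
    by rewrite mmapC /= horner_morphC /w /= mmapC.
  rewrite mmapX mmap1U /h; case: unliftP => [j ->|->].
    by rewrite horner_morphC /w /= mmapX mmap1U.
  by rewrite horner_morphX.
- by move=> c /=; rewrite mmapC.
Qed.

(** A morphism to [R] that fixes the constants is evaluation at the images of the variables. *)
Lemma artin_lang (R : rcfType) n (K : realFieldType)
    (a : {rmorphism {mpoly R[n]} -> K}) (C : seq {mpoly R[n]}) :
  exists v : 'I_n -> R, forall p, p \in C -> sgz (a p) = sgz p.@[v].
Proof.
have [b [bC sC]] := @specializable_mpoly R n K a C.
exists (fun i => b 'X_i) => p /sC ->; congr sgz.
apply: (@mpoly_rmorph_ext _ _ _ b (meval (fun i => b 'X_i))) => [c|i] /=.
  by rewrite bC mevalC.
by rewrite mevalXU.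
Qed.

(** * Sums of squares and the cone generated by finitely many polynomials *)

Lemma is_sosD (R : realType) k (a b : {mpoly R[k]}) :
  is_sos a -> is_sos b -> is_sos (a + b).
Proof. by case=> s -> [t ->]; exists (s ++ t); rewrite big_cat. Qed.

Lemma is_sosM (R : realType) k (a b : {mpoly R[k]}) :
  is_sos a -> is_sos b -> is_sos (a * b).
Proof.
case=> s -> [t ->]; exists [seq x * y | x <- s, y <- t].
rewrite big_allpairs_dep mulr_suml; apply: eq_bigr => x _.
by rewrite mulr_sumr; apply: eq_bigr => y _; rewrite exprMn.
Qed.

Lemma is_sos_sqr (R : realType) k (a : {mpoly R[k]}) : is_sos (a ^+ 2).
Proof. by exists [:: a]; rewrite big_seq1. Qed.

Lemma is_sos0 (R : realType) k : is_sos (0 : {mpoly R[k]}).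
Proof. by exists [::]; rewrite big_nil. Qed.

Lemma is_sos_meval_ge0 (R : realType) k (a : {mpoly R[k]}) v :
  is_sos a -> 0 <= a.@[v].
Proof.
case=> s ->; rewrite rmorph_sum; apply: sumr_ge0 => x _.
by rewrite rmorphXn; apply: sqr_ge0.
Qed.

Definition sos_span (R : realType) N k (G : 'I_k -> {mpoly R[N]}) (x : {mpoly R[N]}) :=
  exists q : {set 'I_k} -> {mpoly R[N]},
    (forall S, is_sos (q S)) /\ x = \sum_(S : {set 'I_k}) q S * \prod_(i in S) G i.

Section SosSpan.
Context (R : realType) (N k : nat) (G : 'I_k -> {mpoly R[N]}).

Lemma sos_span_prod q (S : {set 'I_k}) :
  is_sos q -> sos_span G (q * \prod_(i in S) G i).
Proof.
move=> sq; exists (fun S' => if S' == S then q else 0); split.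
  by move=> S'; case: ifP => // _; apply: is_sos0.
rewrite (bigD1 S) //= eqxx [X in _ + X]big1 ?addr0 // => S' /negPf ->.
by rewrite mul0r.
Qed.

Lemma sos_spanD x y : sos_span G x -> sos_span G y -> sos_span G (x + y).
Proof.
case=> q [sq ->] [q' [sq' ->]]; exists (fun S => q S + q' S); split.
  by move=> S; apply: is_sosD.
by rewrite -big_split; apply: eq_bigr => S _; rewrite mulrDl.
Qed.

Lemma sos_span_sos q : is_sos q -> sos_span G q.
Proof.
move=> /(sos_span_prod finset.set0); rewrite big_pred0 ?mulr1 // => i.
by rewrite finset.in_set0.
Qed.

Lemma sos_span_sum (I : finType) (F : I -> {mpoly R[N]}) :
  (forall i, sos_span G (F i)) -> sos_span G (\sum_i F i).
Proof.
move=> sF; apply: big_ind => //; last exact: sos_spanD.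
by apply: sos_span_sos; apply: is_sos0.
Qed.

(** When [i] is already in [S], the square of [G i] is absorbed by the coefficient. *)
Lemma sos_spanMgen x i : sos_span G x -> sos_span G (x * G i).
Proof.
case=> q [sq ->]; rewrite mulr_suml; apply: sos_span_sum => S.
have [iS|iS] := boolP (i \in S).
  rewrite (big_setD1 i iS) /=.
  have -> (a b : {mpoly R[N]}) : q S * (a * b) * a = q S * a ^+ 2 * b by ring.
  by apply: sos_span_prod; apply: is_sosM => //; apply: is_sos_sqr.
by rewrite -mulrA [_ * G i]mulrC -(big_setU1 i iS); apply: sos_span_prod.
Qed.

Lemma sos_spanM x y : sos_span G x -> sos_span G y -> sos_span G (x * y).
Proof.
move=> sx [q [sq ->]]; rewrite mulr_sumr; apply: sos_span_sum => S.
rewrite mulrA; have : sos_span G (x * q S).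
  case: sx => q' [sq' ->]; exists (fun S' => q' S' * q S); split.
    by move=> S'; apply: is_sosM.
  by rewrite mulr_suml; apply: eq_bigr => S' _; rewrite mulrAC.
(* The generators in the product are brought in one at a time, for an arbitrary element [z] of the
   span. *)
move: (x * q S) => z; elim/big_rec: _ z => [z|i y' _ IH z sz]; first by rewrite mulr1.
by rewrite mulrA; apply: IH; apply: sos_spanMgen.
Qed.

End SosSpan.

(** Without a certificate, the sum of the cone of the [G i] and the ideal of the [E j] avoids [s],
    so in some ordered field the [G i] are nonnegative, the [E j] zero and [s] nonzero. [artin_lang]
    moves these signs to a real point. *)
Theorem positivstellensatz (R : realType) N k l (G : 'I_k -> {mpoly R[N]})
    (E : 'I_l -> {mpoly R[N]}) (s : {mpoly R[N]}) :
  (forall v, (forall i, 0 <= (G i).@[v]) -> (forall j, (E j).@[v] = 0) -> s.@[v] = 0) ->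
  exists (q : {set 'I_k} -> {mpoly R[N]}) (rho : 'I_l -> {mpoly R[N]}) r,
    (forall S, is_sos (q S)) /\
    \sum_(S : {set 'I_k}) q S * \prod_(i in S) G i + s ^+ (2 * r)
      + \sum_j rho j * E j = 0.
Proof.
move=> nopoint; apply: contrapT => nocert.
pose I x := exists rho : 'I_l -> {mpoly R[N]}, x = \sum_j rho j * E j.
pose T x := exists y z, [/\ sos_span G y, I z & x = y + z].
have ID x y : I x -> I y -> I (x + y).
  case=> c -> [d ->]; exists (fun j => c j + d j).
  by rewrite -big_split; apply: eq_bigr => j _; rewrite mulrDl.
have IM x y : I y -> I (x * y).
  case=> c ->; exists (fun j => x * c j).
  by rewrite mulr_sumr; apply: eq_bigr => j _; rewrite mulrA.
have I0 : I 0 by exists (fun=> 0); rewrite big1 // => j _; rewrite mul0r.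
have TG x : sos_span G x -> T x by exists x, 0; rewrite addr0.
have TI x : I x -> T x.
  exists 0, x; rewrite add0r; split=> //; apply: sos_span_sos; exact: is_sos0.
have Tcone : cone T.
  split.
  - move=> _ _ [y [z [sy Iz ->]]] [y' [z' [sy' Iz' ->]]].
    exists (y + y'), (z + z'); split; [exact: sos_spanD|exact: ID|].
    by rewrite addrACA.
  - move=> _ _ [y [z [sy Iz ->]]] [y' [z' [sy' Iz' ->]]].
    exists (y * y'), (y * z' + (y' + z') * z); split; [exact: sos_spanM| |ring].
    by apply: ID; apply: IM.
  - by move=> x; apply/TG/sos_span_sos/is_sos_sqr.
have Ts : avoids s T.
  move=> r [_ [_ [[q [sq ->]] [c ->] e]]]; apply: nocert.
  by exists q, c, r; split=> //; rewrite addrAC -e addNr.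
have [K [a [as0 aT]]] := ordered_field_of_avoiding_cone Tcone Ts.
have [v av] := artin_lang a (s :: map G (enum 'I_k) ++ map E (enum 'I_l)).
have avG i : sgz (a (G i)) = sgz (G i).@[v].
  by apply: av; rewrite in_cons mem_cat (map_f G) ?mem_enum ?orbT.
have avE j : sgz (a (E j)) = sgz (E j).@[v].
  by apply: av; rewrite in_cons mem_cat (map_f E) ?mem_enum ?orbT.
move: as0; rewrite -sgz_eq0 av ?mem_head // sgz_eq0 nopoint ?eqxx // => [i|j].
  rewrite -sgz_ge0 -avG sgz_ge0; apply/aT/TG.
  rewrite -[G i]mul1r; apply: sos_spanMgen; apply: sos_span_sos.
  by rewrite -(expr1n _ 2); apply: is_sos_sqr.
(* Both [E j] and its opposite lie in the ideal, hence in [T]. *)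
apply/eqP; rewrite -sgz_eq0 -avE sgz_eq0; apply/eqP/le_anti.
have IE : I (E j).
  exists (fun j' => (j' == j)%:R); rewrite (bigD1 j) //= eqxx mul1r.
  by rewrite big1 ?addr0 // => j' /negPf ->; rewrite mul0r.
rewrite (aT _ (TI _ IE)) andbT -oppr_ge0 -rmorphN; apply/aT/TI.
by rewrite -mulN1r; apply: IM.
Qed.

(** * The control barrier constraints *)

Section Evaluation.
Context (R : realType) (n p m : nat).
Context (f : 'cV[{mpoly R[n]}]_n) (g : 'M[{mpoly R[n]}]_(n, p)) (h : {mpoly R[n]}).
Context (L : 'I_m -> 'M[R]_p).
Context (v : 'I_(n + m) -> R).

Let x : 'cV[R]_n := \col_k v (lshift m k).
Let y (j : 'I_m) : R := v (rshift n j).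

Lemma meval_lift_x a : (lift_x m a).@[v] = a.@[fun k => x k 0].
Proof.
apply: (@mpoly_rmorph_ext R n R (meval v \o lift_x (R := R) m) (meval (fun k => x k 0))).
  by move=> c /=; rewrite /lift_x comp_mpolyC !mevalC.
by move=> i /=; rewrite /lift_x comp_mpolyXU -tnth_nth tnth_mktuple !mevalXU mxE.
Qed.

Lemma meval_XiTy :
  (XiTy m f h).@[v] = \sum_j mx_eval (cbf_Xi m f h) x j 0 * y j.
Proof.
rewrite /XiTy mxE rmorph_sum; apply: eq_bigr => j _.
by rewrite !mxE rmorphM /= mevalXU meval_lift_x.
Qed.

Lemma meval_ATy i :
  (ATy g h L i 0).@[v] = \sum_j mx_eval (cbf_A g h L) x j i * y j.
Proof.
rewrite /ATy mxE rmorph_sum; apply: eq_bigr => j _.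
by rewrite !mxE rmorphM /= mevalXU meval_lift_x.
Qed.

Lemma meval_phi_list_ge0 :
  (forall i, 0 <= (tnth (phi_list m f h) i).@[v]) <->
  [/\ forall j, 0 <= y j, (XiTy m f h).@[v] <= 0 & 0 <= h.@[fun k => x k 0]].
Proof.
split=> [H|[y0 X0 h0] i].
  split=> [j||].
  - by have := H (lshift 2 j); rewrite tnth_lshift tnth_mktuple mxE mevalXU.
  - have := H (rshift m ord0); rewrite tnth_rshift (tnth_nth 0) /= mevalN.
    by rewrite oppr_ge0.
  - have := H (rshift m ord_max); rewrite tnth_rshift (tnth_nth 0) /=.
    by rewrite meval_lift_x.
case: (split_ordP i) => [j ->|j ->].
  by rewrite tnth_lshift tnth_mktuple mxE mevalXU y0.
rewrite tnth_rshift (tnth_nth 0); case: j => [[|[|//]] /= _].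
  by rewrite mevalN oppr_ge0.
by rewrite meval_lift_x.
Qed.

End Evaluation.

Lemma mx_eval_cbf_A (R : realType) n p m (g : 'M[{mpoly R[n]}]_(n, p)) h
    (L : 'I_m -> 'M[R]_p) x j i :
  failure_pattern (L j) ->
  mx_eval (cbf_A g h L) x j i
  = - ((gradient h *m g) 0 i).@[fun k => x k 0] * L j i i.
Proof.
case=> /is_diag_mxP Ldiag _.
rewrite /mx_eval /cbf_A 2!mxE mxE mevalN mxE rmorph_sum (bigD1 i) //=.
rewrite big1 ?addr0 => [|k ki]; last first.
  by rewrite rmorphM /= [map_mx _ _ _ _]mxE mevalC Ldiag ?mulr0.
by rewrite rmorphM /= [map_mx _ _ _ _]mxE mevalC mulNr.
Qed.

Theorem lemma8 (R : realType) (n p m : nat)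
  (f : 'cV[{mpoly R[n]}]_n) (g : 'M[{mpoly R[n]}]_(n, p)) (h : {mpoly R[n]})
  (L : 'I_m -> 'M[R]_p)
  (L_pattern : forall j, failure_pattern (L j))
  (L_controllable : forall j, controllable f g (L j)) :
  (forall x : 'cV[R]_n, 0 <= h.@[fun k => x k 0] ->
     exists u : 'cV[R]_p, forall j : 'I_m,
       (mx_eval (cbf_A g h L) x *m u) j 0 <= mx_eval (cbf_Xi m f h) x j 0)
  <->
  (exists (rho : 'I_p -> 'I_m -> {mpoly R[n + m]})
          (q : {set 'I_(m + 2)} -> {mpoly R[n + m]}) (r : nat),
     (forall S, is_sos (q S)) /\
     phi f h q + chi m f h r + psi g h L rho = 0).
Proof.
split=> [feasible|[rho [q [r [sq cert]]]] x hx].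
  have [|q [c [r [sq cert]]]] := @positivstellensatz R (n + m) (m + 2) p
      (tnth (phi_list m f h)) (fun i => ATy g h L i 0) (XiTy m f h).
    move=> v /meval_phi_list_ge0 [y0 X0 h0] A0.
    have [u uX] := feasible _ h0.
    apply/le_anti; rewrite X0 meval_XiTy.
    (* Weighted by [y >= 0], the constraints bound [Xi^T y] below by [u^T A^T y], which is 0. *)
    apply: le_trans (_ : \sum_j (mx_eval (cbf_A g h L) _ *m u) j 0 * _ <= _); last first.
      by apply: ler_sum => j _; apply: ler_wpM2r; [exact: y0|exact: uX].
    under eq_bigr => j _ do rewrite mxE mulr_suml.
    rewrite exchange_big big1 //= => i _.
    under eq_bigr => j _ do rewrite mulrAC.
    by rewrite -mulr_suml -meval_ATy A0 mul0r.
  (* The entries of [A^T y] do not depend on [j], so all cofactors are put at one index [j0]. If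
     [m = 0] there is no index, but then [A^T y] is zero. *)
  have [j0 _|m0] := pickP (fun _ : 'I_m => true).
    exists (fun i j => if j == j0 then c i else 0), q, r; split=> //.
    apply: etrans cert; congr (_ + _); rewrite /psi (bigD1 j0) //= eqxx.
    rewrite [X in _ + X]big1 ?addr0 // => j /negPf ->.
    by rewrite big1 // => i _; rewrite mul0r.
  exists (fun _ _ => 0), q, r; split=> //.
  apply: etrans cert; congr (_ + _); rewrite /psi big1 => [|j]; last by have := m0 j.
  apply/esym/big1 => i _; rewrite /ATy mxE big1 ?mulr0 // => j.
  by have := m0 j.
set xi := (cbf_xi f h).@[fun k => x k 0].
have XiE j : mx_eval (cbf_Xi m f h) x j 0 = xi by rewrite !mxE.
have [xi0|xi0] := leP 0 xi.
  by exists 0 => j; rewrite mulmx0 mxE XiE.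
pose w i := ((gradient h *m g) 0 i).@[fun k => x k 0].
pose A j i := mx_eval (cbf_A g h L) x j i.
have AE j i : A j i = - w i * L j i i by apply: mx_eval_cbf_A.
(* This is the squared norm of [L_j w], since the diagonal entries are 0 or 1, and the opposite of
   row [j] of [A] applied to [w]. *)
pose d j := \sum_i w i ^+ 2 * L j i i.
have L01 j i : 0 <= L j i i by have [_ /(_ i) [] ->] := L_pattern j.
have d0 j : 0 < d j.
  rewrite lt_neqAle eq_sym sumr_ge0 ?andbT; last first.
    by move=> i _; rewrite mulr_ge0 ?sqr_ge0.
  apply/negP => /eqP dj0.
  have A0 i : A j i = 0.
    have /eqP : w i ^+ 2 * L j i i = 0.
      apply: (psumr_eq0P (F := fun i => w i ^+ 2 * L j i i)) dj0 _ _ => // k _.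
      by rewrite mulr_ge0 ?sqr_ge0.
    by rewrite AE !mulf_eq0 /= orbb => /orP [] /eqP->; rewrite ?oppr0 ?mul0r ?mulr0.
  (* The evaluation point is [x] followed by the [j]-th unit vector. *)
  pose v (k : 'I_(n + m)) : R :=
    match split k with inl k' => x k' 0 | inr j' => (j' == j)%:R end.
  have xE : (\col_k v (lshift m k)) = x.
    by apply/colP => k; rewrite mxE /v -[lshift _ _]/(unsplit (inl k)) unsplitK.
  have vE j' : v (rshift n j') = (j' == j)%:R.
    by rewrite /v -[rshift _ _]/(unsplit (inr j')) unsplitK.
  have XiTy_v : (XiTy m f h).@[v] = xi.
    rewrite meval_XiTy (bigD1 j) //= vE eqxx mulr1 xE XiE.
    by rewrite big1 ?addr0 // => j' /negPf j'j; rewrite vE j'j mulr0.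
  have phi_v : 0 <= (phi f h q).@[v].
    rewrite rmorph_sum; apply: sumr_ge0 => S _; rewrite rmorphM /=.
    apply: mulr_ge0; first exact: is_sos_meval_ge0.
    rewrite rmorph_prod; apply: prodr_ge0 => i _; move: i.
    apply/meval_phi_list_ge0; rewrite xE; split=> // [j'|].
      by rewrite vE ler0n.
    by rewrite XiTy_v ltW.
  have psi_v : (psi g h L rho).@[v] = 0.
    rewrite rmorph_sum big1 // => j' _; rewrite rmorph_sum big1 // => i _.
    rewrite rmorphM /= meval_ATy xE (bigD1 j) //= [mx_eval _ _ _ _](A0 i) mul0r add0r.
    by rewrite big1 ?mulr0 // => k /negPf kj; rewrite vE kj mulr0.
  have /eqP := congr1 (meval v) cert.
  (* What remains is a nonnegative number plus a power of [xi ^+ 2], which is positive as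
     [xi < 0]. *)
  rewrite !rmorphD /= psi_v addr0 meval0 rmorphXn /= XiTy_v exprM.
  rewrite gt_eqF // ltr_wpDl //; apply: exprn_gt0.
  by rewrite exprn_even_gt0 //= lt_eqF.
(* All terms are positive, so [c >= - xi / d j] for every [j] at once. *)
pose c := \sum_j - xi / d j.
exists (\col_i (c * w i)) => j.
have -> : (mx_eval (cbf_A g h L) x *m \col_i (c * w i)) j 0 = - (c * d j).
  rewrite mxE -mulrN -sumrN mulr_sumr; apply: eq_bigr => i _.
  by rewrite [mx_eval _ _ _ _]AE mxE; ring.
rewrite XiE lerNl -ler_pdivrMr // /c (bigD1 j) //= lerDl.
by apply: sumr_ge0 => k _; rewrite divr_ge0 ?oppr_ge0 ?ltW.
Qed.
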